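(* For every positive integer $n$, the bijection $\rho^{(n)}:\mathcal{LR}^{(n)}\to\mathcal{LR}^{(n)}$, sending each Littlewood--Richardson tableau $T\in\mathcal{LR}^{(n)}$ to its partner tableau $S$, is an involution; that is, $\rho^{(n)}(\rho^{(n)}(T))=T$ for all $T\in\mathcal{LR}^{(n)}$.
   Context: Partitions and tableaux. A partition $\lambda=(\lambda_1\ge\lambda_2\ge\cdots)$ has $\ell(\lambda)$ positive parts and weight $|\lambda|=\sum_i\lambda_i$; trailing zeros may be added. $\mu\subseteq\lambda$ means $\mu_i\le\lambda_i$ for all $i$. $D(\lambda)=\{(i,j):1\le i\le\ell(\lambda),1\le j\le\lambda_i\}$ is its Young diagram, row $i$ counted from the top and column $j$ from the left; a corner is a cell whose removal leaves the Young diagram of a partition. A tableau $T$ of shape $\lambda/\mu$ (outer shape $\lambda$, inner shape $\mu$, $\mu\subseteq\lambda$) is a map $D(\lambda)\setminus D(\mu)\to\{1,2,\dots\}$, extended by $T(i,j)=0$ (''empty cell'') for $(i,j)\in D(\mu)$. Its weight is the sequence whose $s$-th term is the number of entries $s$. $T$ is semistandard if its positive entries weakly increase from left to right along rows and strictly increase down columns. $T$ has the lattice permutation property if for all $r\ge1$, $s\ge2$ the number of entries $s$ in the first $r$ rows is at most the number of entries $s-1$ in the first $r-1$ rows. A Littlewood--Richardson (LR) tableau is one that is semistandard and has the lattice permutation property. $\mathcal{LR}(\lambda/\mu,\nu)$ is the set of LR tableaux of shape $\lambda/\mu$ and weight $\nu$; $\mathcal{LR}^{(n)}$ is the union of all $\mathcal{LR}(\lambda/\mu,\nu)$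 with $\ell(\lambda)\le n$. Deletion operators. Let $T$ be an LR tableau of shape $\lambda/\mu$ and $(r,\lambda_r)$ a corner of $D(\lambda)$. The deletion operator $\delta_{r,\lambda_r}$ acts on $T$ as follows. (i) If $T(r,\lambda_r)=r$, the cell $(r,\lambda_r)$ is removed, and the terminating row number is $0$. (ii) If $0<T(r,\lambda_r)<r$, remove the cell $(r,\lambda_r)$ with its entry $c_r$; then for $s=r-1,r-2,\dots$ let $c_{s+1}$ replace the rightmost entry of row $s$ (zeros included) that is strictly less than $c_{s+1}$, and call the replaced entry $c_s$; stop as soon as $c_s=0$. The terminating row number is the row $k=s$ in which this happens; the outer shape loses $(r,\lambda_r)$ and the inner shape loses its corner $(k,\mu_k)$. (iii) If $T(r,\lambda_r)=0$, the cell $(r,\lambda_r)=(r,\mu_r)$ is removed from both outer and inner shapes, and the terminating row number is $r$. Full $r$-deletion. If $T$ is an LR tableau with outer shape $\lambda$ and $\ell(\lambda)=r$, then $\delta_r=\delta_{r,1}\delta_{r,2}\cdots\delta_{r,\lambda_r}$, with $\delta_{r,\lambda_r}$ acting first and $\delta_{r,1}$ last. If $\ell(\lambda)<r$, $\delta_r$ does nothing. Partner tableau. For $T\in\mathcal{LR}^{(n)}$ with outer shape $\lambda$, set $T^{(n)}=T$ and $T^{(r-1)}=\delta_rT^{(r)}$ for $r=n,n-1,\dots,1$. The partner tableau $S=\rho^{(n)}(T)$ is the filling of $D(\lambda)$ whose row $r$ consists, from left to right, of the $\lambda_r$ terminating row numbers (including zeros) of the operations constituting $\delta_r$ applied to $T^{(r)}$,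 in order of occurrence; cells containing $0$ are regarded as empty (inner-shape) cells. (The map $\rho^{(n)}$ restricts to bijections $\mathcal{LR}(\lambda/\mu,\nu)\to\mathcal{LR}(\lambda/\nu,\mu)$.) *)

(* Defs.v *)
From mathcomp Require Import all_boot.

Set Implicit Arguments.
Unset Strict Implicit.
Unset Printing Implicit Defensive.

(* Rows, columns, parts and tableau entries are numbered from 1.  Partitions
   are stored without trailing zeros; [part lam i] is zero beyond the last
   positive part. *)

Definition is_part (lam : seq nat) : bool := sorted geq lam && (0 \notin lam).

Definition part (lam : seq nat) (i : nat) : nat := nth 0 lam i.-1.

Definition part_sub (mu lam : seq nat) : Prop :=
  forall i, 1 <= i -> part mu i <= part lam i.

Definition diagram (lam : seq nat) : pred (nat * nat) :=
  [pred c | (1 <= c.1 <= size lam) && (1 <= c.2 <= part lam c.1)].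

(* A tableau of shape lam/mu is stored as the list of the rows of its extension
   by zero to the whole diagram of lam, from top to bottom, empty rows being
   omitted.  Thus the zeros are exactly the cells of mu. *)
Definition tableau : Type := seq (seq nat).

Definition entry (T : tableau) (i j : nat) : nat :=
  nth 0 (nth [::] T i.-1) j.-1.

Definition outer (T : tableau) : seq nat := [seq size row | row <- T].

Definition has_shape (lam mu : seq nat) (T : tableau) : Prop :=
  [/\ is_part lam, is_part mu, part_sub mu lam, outer T = lam
    & forall i j, (i, j) \in diagram lam ->
        (entry T i j == 0) = ((i, j) \in diagram mu)].

Definition has_weight (nu : seq nat) (T : tableau) : Prop :=
  is_part nu /\ forall s, 1 <= s -> count_mem s (flatten T) = part nu s.

Definition semistandard (T : tableau) : Prop :=
  (forall i j j', (i, j) \in diagram (outer T) -> (i, j') \in diagram (outer T) ->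
     0 < entry T i j -> 0 < entry T i j' -> j < j' ->
     entry T i j <= entry T i j') /\
  (forall i i' j, (i, j) \in diagram (outer T) -> (i', j) \in diagram (outer T) ->
     0 < entry T i j -> 0 < entry T i' j -> i < i' ->
     entry T i j < entry T i' j).

Definition lattice_permutation (T : tableau) : Prop :=
  forall r s, 1 <= r -> 2 <= s ->
    count_mem s (flatten (take r T)) <= count_mem s.-1 (flatten (take r.-1 T)).

Definition LR (lam mu nu : seq nat) (T : tableau) : Prop :=
  [/\ has_shape lam mu T, has_weight nu T, semistandard T
    & lattice_permutation T].

Definition LRn (n : nat) (T : tableau) : Prop :=
  exists lam mu nu, size lam <= n /\ LR lam mu nu T.

(* The 0-based position of the rightmost entry of [row] smaller than [c]; the
   default 0 is irrelevant for LR tableaux, where such an entry exists. *)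
Definition rightmost_lt (c : nat) (row : seq nat) : nat :=
  last 0 [seq j <- iota 0 (size row) | nth 0 row j < c].

(* Insert c = c_(s+1) into row s and go on upwards, returning the new tableau
   and the terminating row number.  On LR tableaux the chain always stops in
   some row s >= 1, so the value for s = 0 is irrelevant. *)
Fixpoint bump_up (s c : nat) (T : tableau) : tableau * nat :=
  if s is s'.+1 then
    let row := nth [::] T s' in
    let j := rightmost_lt c row in
    let c' := nth 0 row j in
    let T' := set_nth [::] T s' (set_nth 0 row j c) in
    if c' == 0 then (T', s) else bump_up s' c' T'
  else (T, 0).

Definition remove_last (r : nat) (T : tableau) : tableau :=
  let row := nth [::] T r.-1 in
  [seq row' <- set_nth [::] T r.-1 (take (size row).-1 row) | row' != [::]].

(* The operator delta_(r, lam_r), together with its terminating row number. It is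
   meaningful when (r, lam_r) is a corner of the outer shape lam of T. *)
Definition corner_deletion (r : nat) (T : tableau) : tableau * nat :=
  let c := last 0 (nth [::] T r.-1) in
  let T' := remove_last r T in
  if c == r then (T', 0)
  else if c == 0 then (T', r)
  else bump_up r.-1 c T'.

Fixpoint corner_deletions (r m : nat) (T : tableau) : tableau * seq nat :=
  if m is m'.+1 then
    let: (T', k) := corner_deletion r T in
    let: (T'', ks) := corner_deletions r m' T' in
    (T'', k :: ks)
  else (T, [::]).

(* delta_r, together with its terminating row numbers in order of occurrence;
   it is only meaningful for outer shapes of length at most r. *)
Definition full_deletion (r : nat) (T : tableau) : tableau * seq nat :=
  if size T == r then corner_deletions r (part (outer T) r) T else (T, [::]).

(* [residual n T k] is T^(n - k). *)
Fixpoint residual (n : nat) (T : tableau) (k : nat) : tableau :=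
  if k is k'.+1 then (full_deletion (n - k') (residual n T k')).1 else T.

Definition partner (n : nat) (T : tableau) : tableau :=
  [seq (full_deletion r (residual n T (n - r))).2 | r <- iota 1 (size T)].

(* Main.v *)
Require Import Defs.
From mathcomp Require Import all_boot.
From mathcomp Require Import zify.

Set Implicit Arguments.
Unset Strict Implicit.
Unset Printing Implicit Defensive.

(** Forget the zeros of a tableau and the entries s of its row s. Any other
    entry c of row r satisfies 0 < c < r and stands for the interval
    [c, r - 1]. A deletion then shortens the intervals of a chain whose left
    ends decrease, and a terminating row k found while row r is being emptied
    stands for the interval [k, r - 1]. In these terms the partner map is the
    algorithm of Moeglin and Waldspurger on multisegments, that is, multisets
    of intervals; it is [dual] below, and the theorem comes from the fact that
    this algorithm is an involution. The forgotten entries are treated as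
    virtual: row s has an unlimited supply of zeros and of entries s.

    Let [climb c M = (Q, d)]: the letter c enters M from below, M becomes Q,
    and the terminating row is k = size M + 1 - d. The heart of the proof is
    [climb_dual]: when k enters the dual of Q, the result is the dual of M and
    the terminating row is c. Applying it to the letters of the bottom row,
    from the last one removed back to the first, gives [dualK].

    The proof of [climb_dual] is an induction on the number of rows. If the
    letter c enters the bottom row w, turns it into w' and sends c' upwards,
    then the words (w, then c) and (c', then w') are linked by elementary Knuth
    moves ([exchange_spec]). An elementary move on letters entering a
    multisegment does not change the result, and the depths of the chains
    undergo a move given by the same rule ([climbs_knuth]). So the terminating
    rows of the two words are exchanged by the rule of [exchange] as well; read
    backwards, this says that k enters the bottom row of the dual of Q, turns
    it into the bottom row of the dual of M and sends upwards the letter to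
    which the induction hypothesis applies.

    It remains to see that partners of Littlewood-Richardson tableaux are
    Littlewood-Richardson tableaux. For given inner shape mu and weight nu,
    column strictness of rows i and i + 1 is a bound by mu_i - mu_(i+1) on the
    interior entries of these rows, and the lattice condition for i and i + 1
    is a bound by nu_i - nu_(i+1) on the interior entries i and i + 1. Following
    one climbing letter at a time shows that [dual] transforms the first bound
    into the second one ([lattice_at_dual]), and then by [dualK] also the second
    into the first. The column bounds guarantee moreover that the true zeros of
    the tableau suffice, so that the virtual ones are never used up:
    [partner_fill] states that [partner] is [dual] with the zeros and the
    diagonal entries restored, the inner shape and the weight being
    interchanged. *)

(** * One row *)

Definition interior (s x : nat) : bool := 0 < x < s.

(** The virtual entry s is put in front of the row; the virtual zero is the
    default of the maximum. *)
Definition below (s c : nat) (a : seq nat) : nat := \max_(x <- s :: a | x < c) x.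

(** When [below s c a] is a virtual entry, [rem] does nothing: the supply is
    unlimited. For the same reason a letter c = s is not stored. *)
Definition put (s c : nat) (a : seq nat) : seq nat :=
  sort leq [seq x <- c :: rem (below s c a) a | interior s x].

Definition wf_row (s : nat) (a : seq nat) : bool :=
  sorted leq a && all (interior s) a.

Lemma mem_count (x : nat) (a : seq nat) : (x \in a) = (0 < count_mem x a).
Proof. by rewrite -has_count has_pred1. Qed.

Lemma below_max s c a x : x \in s :: a -> x < c -> x <= below s c a.
Proof.
move=> xa xc; rewrite /below.
exact: (@leq_bigmax_seq _ _ (fun x => x < c) id).
Qed.

Lemma below_in s c a : below s c a \in [:: 0, s & a].
Proof.
rewrite /below; elim: (s :: a) => [|y r IH]; first by rewrite big_nil.
rewrite big_cons; case: ifP => _.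
  rewrite /maxn; case: ifP => _; last by rewrite !inE eqxx orbT.
  by move: IH; rewrite !inE => /orP[->|->]; rewrite ?orbT.
by move: IH; rewrite !inE => /orP[->|->]; rewrite ?orbT.
Qed.

Lemma below_lt s c a : 0 < c -> below s c a < c.
Proof.
move=> c0; rewrite /below; elim: (s :: a) => [|y r IH]; first by rewrite big_nil.
by rewrite big_cons; case: ifP => // yc; rewrite gtn_max yc.
Qed.

Lemma below_eq s c a p : p < c -> p \in [:: 0, s & a] ->
  (forall t, t \in s :: a -> t < c -> t <= p) -> below s c a = p.
Proof.
move=> pc pin pmax; apply/eqP; rewrite eqn_leq; apply/andP; split.
  have blt : below s c a < c by apply: below_lt; lia.
  have := below_in s c a; rewrite inE => /orP[/eqP->//|bin].
  exact: pmax.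
move: pin; rewrite inE => /orP[/eqP->//|pin]; exact: below_max.
Qed.

Lemma count_put s c a d : wf_row s a -> 0 < c ->
  interior s d ->
  count_mem d (put s c a) + (d == below s c a) = count_mem d a + (d == c).
Proof.
move=> /andP[_ /allP aint] c0 ds.
have blt := below_lt s a c0.
rewrite /put count_sort count_filter.
rewrite (@eq_count _ _ (pred1 d)); last first.
  by move=> x /=; case: eqP => [->|//]; rewrite ds.
have bin := below_in s c a.
have -> : count_mem d (c :: rem (below s c a) a) =
   (d == c) + count_mem d (rem (below s c a) a).
  by rewrite /= eq_sym.
rewrite count_mem_rem [below s c a == d]eq_sym.
case: (d =P below s c a) => [E|_] /=; last by lia.
have din : d \in a.
  by move: ds bin; rewrite -E !inE => /andP[d0 dls] /or3P[/eqP|/eqP|//]; lia.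
by move: din; rewrite mem_count => din; rewrite -addnA subnK 1?addnC.
Qed.

Lemma wf_put s c a : wf_row s (put s c a).
Proof.
apply/andP; split; first exact/sort_sorted/leq_total.
rewrite /put all_sort; exact: filter_all.
Qed.

Lemma wf_row_ext s a b : wf_row s a -> wf_row s b ->
  (forall d, interior s d -> count_mem d a = count_mem d b) -> a = b.
Proof.
move=> /andP[sa aint] /andP[sb bint] H.
apply: (sorted_eq leq_trans anti_leq sa sb).
apply/allP => d; rewrite mem_cat => din; apply/eqP/H.
by case/orP: din => [/(allP aint)|/(allP bint)].
Qed.

Lemma mem_put s c a x : wf_row s a -> 0 < c -> x \in put s c a ->
   (x == c) || (x \in a).
Proof.
move=> wa c0 xp.
have xs : interior s x by have /andP[_ /allP] := wf_put s c a; exact.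
have := count_put wa c0 xs.
move: xp; rewrite !mem_count; case: (x == c) => //=; lia.
Qed.

Lemma put_mem s c a x : wf_row s a -> 0 < c -> interior s x ->
   x != below s c a -> (x == c) || (x \in a) -> x \in put s c a.
Proof.
move=> wa c0 xs xb.
have := count_put wa c0 xs; rewrite (negbTE xb).
rewrite !mem_count; case: (x == c) => //=; lia.
Qed.

Lemma put_self s c a : wf_row s a -> interior s c -> c \in put s c a.
Proof.
move=> wa cs; have c0 : 0 < c by case/andP: cs.
apply: put_mem => //; last by rewrite eqxx.
by have := below_lt s a c0; lia.
Qed.

(** * A letter climbing through all rows *)

(** The bottom row comes first, so that the head of M has row number size M.
    The second component is the number of rows that a nonzero letter has
    entered, row 0 included: if it is d, the terminating row number is size M
    + 1 - d. *)
Fixpoint climb (c : nat) (M : seq (seq nat)) : seq (seq nat) * nat :=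
  if c == 0 then (M, 0)
  else if M is a :: P then
    let: (Q, d) := climb (below (size M) c a) P in
    (put (size M) c a :: Q, d.+1)
  else ([::], 1).

Fixpoint wf (M : seq (seq nat)) : bool :=
  if M is a :: P then wf_row (size M) a && wf P else true.

Lemma climb0 M : climb 0 M = (M, 0).
Proof. by case: M. Qed.

Lemma climb_cons c a P : 0 < c ->
  climb c (a :: P) =
    (put (size P).+1 c a :: (climb (below (size P).+1 c a) P).1,
     (climb (below (size P).+1 c a) P).2.+1).
Proof. by case: c => // c _ /=; case: climb. Qed.

Lemma size_climb c M : size (climb c M).1 = size M.
Proof.
elim: M c => [|a P IH] [|c] //.
by rewrite climb_cons //= IH.
Qed.

Lemma wf_climb c M : wf M -> wf (climb c M).1.
Proof.
elim: M c => [|a P IH] [|c] // /andP[wa wP].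
by rewrite climb_cons //= size_climb wf_put IH.
Qed.

Lemma depth_eq0 c M : ((climb c M).2 == 0) = (c == 0).
Proof. by case: M c => [|a P] [|c] //; rewrite climb_cons. Qed.

Lemma depth_le c M : c <= size M -> (climb c M).2 <= size M.
Proof.
elim: M c => [|a P IH] [|c] // cM; rewrite climb_cons //=.
apply/IH; have := below_lt (size P).+1 a (ltn0Sn c); move: cM => /=; lia.
Qed.

(** In every row s the virtual entry s is replaced by the virtual entry s, so
    that nothing moves. This is why the deletion of an entry r from row r, of
    terminating row number 0, is no exception here. *)
Lemma climb_top M : wf M -> climb (size M).+1 M = (M, (size M).+1).
Proof.
elim: M => // a P IH /andP[wa wP]; rewrite climb_cons //.
have -> : below (size P).+1 (size (a :: P)).+1 a = (size P).+1.
  apply: below_eq => //; rewrite ?inE ?eqxx ?orbT // => t _ /=; lia.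
rewrite IH //=; congr (_ :: _, _).
have bE : below (size P).+1 (size P).+2 a = (size P).+1.
  apply: below_eq => //; rewrite ?inE ?eqxx ?orbT // => t _ /=; lia.
apply: (wf_row_ext (wf_put _ _ _) wa) => d ds.
have := count_put wa (ltn0Sn (size P).+1) ds; rewrite bE.
case/andP: ds => d0 ds.
by rewrite (ltn_eqF ds) (ltn_eqF (ltnW ds : d < (size P).+2)) !addn0.
Qed.

Lemma depth_le_top c M : wf M -> c <= (size M).+1 -> (climb c M).2 <= (size M).+1.
Proof.
move=> wM; rewrite leq_eqVlt => /orP[/eqP->|cM]; first by rewrite climb_top.
by have := depth_le cM; lia.
Qed.

(** An entry smaller than the second letter is smaller than the first one
    too, and was already in the row when that one came; so in each row the
    second letter sends up a letter no larger than the first did. *)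
Lemma climb_weak c1 c2 M : wf M -> c2 <= c1 ->
  (climb c2 (climb c1 M).1).2 <= (climb c1 M).2.
Proof.
elim: M c1 c2 => [|a P IH] c1 [|c2] // wM c21; try by rewrite climb0.
  by case: c1 c21.
case/andP: wM => wa wP.
have c1p : 0 < c1 by lia.
rewrite (climb_cons a P c1p) /= size_climb.
set a1 := put _ _ _; set P1 := (climb _ P).1.
have := IH (below (size P).+1 c1 a) (below (size P).+1 c2.+1 a1) wP.
rewrite -/P1; case: (climb (below _ c2.+1 _) _) => Q d /= H.
apply: H.
have := below_in (size P).+1 c2.+1 a1.
have blt := below_lt (size P).+1 a1 (ltn0Sn c2).
rewrite !inE => /or3P[/eqP->//|/eqP E|din].
  by rewrite E; apply: below_max; rewrite ?inE ?eqxx //; lia.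
have := mem_put wa c1p din => /orP[/eqP|da]; first by lia.
by apply: below_max; rewrite ?inE ?da ?orbT //; lia.
Qed.

(** In each row the second letter finds the first one and sends up a letter
    at least as large, whereas the first letter sent up a smaller one than
    itself. *)
Lemma climb_strict c1 c2 M : wf M -> c1 < c2 <= (size M).+1 ->
  (climb c1 M).2 < (climb c2 (climb c1 M).1).2.
Proof.
elim: M c1 c2 => [|a P IH] [|c1] c2 // wM /andP[c12 c2M].
- by move: c12 c2M => /=; case: c2 => [|[]].
- by move: c12 c2M => /=; case: c2 => [|[]].
- by rewrite climb0 lt0n depth_eq0; lia.
case/andP: wM => wa wP.
rewrite (climb_cons a P) //.
set a1 := put _ _ _; set P1 := (climb _ P).1.
rewrite climb_cons; last by lia.
rewrite ltnS size_climb; apply: IH => //.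
have blt1 := below_lt (size P).+1 a (ltn0Sn c1).
have blt2 : below (size P).+1 c2 a1 < c2 by apply: below_lt; lia.
have : c1.+1 <= below (size P).+1 c2 a1.
  apply: below_max => //; rewrite inE.
  have [->//|ne] := eqVneq c1.+1 (size P).+1.
  by rewrite put_self ?orbT // /interior; move: c2M => /=; lia.
move: c2M => /=; lia.
Qed.

(** * Knuth moves in one row *)

Lemma below_le s c a p : (forall t, t \in s :: a -> t < c -> t <= p) ->
  0 < c -> below s c a <= p.
Proof.
move=> H c0; have := below_in s c a; rewrite inE => /orP[/eqP->//|/H]; apply.
exact: below_lt.
Qed.

Lemma below_shrink s b c a : below s c a < b <= c -> below s b a = below s c a.
Proof.
move=> /andP[bb bc]; apply: below_eq => // [|t ta tb]; first exact: below_in.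
by apply: below_max => //; lia.
Qed.

Lemma below_put_high s b c a : wf_row s a -> 0 < b <= below s c a -> 0 < c ->
  below s b (put s c a) = below s b a.
Proof.
move=> wa /andP[b0 bb] c0.
have bc := below_lt s a c0.
have ba := below_lt s a b0.
apply: below_eq => // [|t].
  have := below_in s b a; rewrite !inE => /or3P[->|->|pa]; rewrite ?orbT //.
  rewrite put_mem ?pa ?orbT //; first by case/andP: wa => _ /allP; apply.
  by rewrite ltn_eqF //; lia.
rewrite inE => /orP[ts tb|]; first by apply: below_max => //; rewrite inE ts.
move/(mem_put wa c0) => /orP[/eqP->|ta] tb; first by lia.
by apply: below_max => //; rewrite inE ta orbT.
Qed.

Lemma below_put_low s b c a : wf_row s a -> 0 < b <= below s c a -> b < c ->
  below s c (put s b a) = below s c a.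
Proof.
move=> wa /andP[b0 bb] bc.
have c0 : 0 < c by lia.
have ca := below_lt s a c0.
have ba := below_lt s a b0.
apply: below_eq => // [|t].
  have := below_in s c a; rewrite !inE => /or3P[->|->|pa]; rewrite ?orbT //.
  rewrite put_mem ?pa ?orbT //; first by case/andP: wa => _ /allP; apply.
  by rewrite gtn_eqF //; lia.
rewrite inE => /orP[ts tb|]; first by apply: below_max => //; rewrite inE ts.
move/(mem_put wa b0) => /orP[/eqP->|ta] tb //.
by apply: below_max => //; rewrite inE ta orbT.
Qed.

Lemma put_self_or_virtual s c a : wf_row s a -> 0 < c <= s -> c \in s :: put s c a.
Proof.
move=> wa /andP[c0]; rewrite leq_eqVlt inE => /orP[->//|cs].
by rewrite put_self ?orbT // /interior c0.
Qed.

(** For y <= z < x, z enters first in either order. The letter x replaces an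
    entry that is at least z, whereas y replaces an entry smaller than y, so
    that x and y do not interfere. *)
Lemma row_knuth_lt s a x y z : wf_row s a -> 0 < y <= z -> z < x <= s.+1 ->
  let a1 := put s z a in
  [/\ below s x (put s y a1) = below s x a1,
      below s y (put s x a1) = below s y a1,
      put s y (put s x a1) = put s x (put s y a1)
    & below s z a < below s x a1].
Proof.
move=> wa /andP[y0 yz] /andP[zx xs] a1.
have z0 : 0 < z by lia.
have x0 : 0 < x by lia.
have w1 : wf_row s a1 := wf_put _ _ _.
have zb : z <= below s x a1 by apply: below_max => //; apply: put_self_or_virtual => //; lia.
have bz := below_lt s a z0.
have E1 : below s x (put s y a1) = below s x a1 by apply: below_put_low; lia.
have E2 : below s y (put s x a1) = below s y a1 by apply: below_put_high; lia.
split=> //; last by lia.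
apply: (wf_row_ext (wf_put _ _ _) (wf_put _ _ _)) => d ds.
have := count_put w1 x0 ds; have := count_put w1 y0 ds.
have := count_put (wf_put s y a1) x0 ds; have := count_put (wf_put s x a1) y0 ds.
rewrite E1 E2; lia.
Qed.

(** For y < x <= z, the letter x enters last in either order. If the row has
    an entry in [y, z[, then y and z do not interfere. Otherwise y and z
    compete for the same entry, say p. In the order z, y, x the letter z
    takes p, y takes the next smaller entry and x takes y; in the order y, z,
    x the letter y takes p, z takes y and x takes that next smaller entry. *)
Lemma row_knuth_le s a x y z : wf_row s a -> 0 < y < x -> x <= z <= s.+1 ->
  let a1 := put s z a in
  let a2 := put s y a1 in
  let b1 := put s y a in
  let b2 := put s z b1 in
  let z' := below s z a in
  let y' := below s y a1 in
  let x' := below s x a2 in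
  put s x b2 = put s x a2 /\
  (below s y a, below s z b1, below s x b2) =
     if z' < x' then (z', x', y') else (y', z', x').
Proof.
move=> wa /andP[y0 yx] /andP[xz zs] a1 a2 b1 b2 z' y' x'.
have z0 : 0 < z by lia.
have x0 : 0 < x by lia.
have w1 : wf_row s a1 := wf_put _ _ _.
have w2 : wf_row s a2 := wf_put _ _ _.
have v1 : wf_row s b1 := wf_put _ _ _.
have v2 : wf_row s b2 := wf_put _ _ _.
have zlt : z' < z := below_lt s a z0.
have bx t : t \in s :: a1 -> t < x -> t <= z'.
  rewrite inE => /orP[/eqP-> sx|/(mem_put wa z0) /orP[/eqP->|ta] tx]; try by lia.
    by apply: below_max; rewrite ?inE ?eqxx //; lia.
  by apply: below_max; rewrite ?inE ?ta ?orbT //; lia.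
have [yz'|z'y] := leqP y z'.
  have E1 : y' = below s y a by apply: below_put_high; lia.
  have E2 : below s z b1 = z' by apply: below_put_low; lia.
  have E : b2 = a2.
    apply: (wf_row_ext v2 w2) => d ds.
    have := count_put wa z0 ds; have := count_put wa y0 ds.
    have := count_put w1 y0 ds; have := count_put v1 z0 ds.
    by rewrite E2 -/y' E1 -/z' -/a1 -/a2 -/b1 -/b2; lia.
  have x'z' : x' <= z'.
    apply: below_le => // t; rewrite inE => /orP[ts|].
      by apply: bx; rewrite inE ts.
    by move=> /(mem_put w1 y0) /orP[/eqP->//|ta]; apply: bx; rewrite inE ta orbT.
  by rewrite E E2 -E1 ltnNge x'z'.
have E1 : below s y a = z' by apply: below_shrink; lia.
have ys : y <= s by lia.
have E2 : x' = y.
  apply: below_eq => // [|t].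
    by rewrite inE put_self_or_virtual ?orbT // y0.
  rewrite inE => /orP[ts|]; first by move=> tx; have := bx t; rewrite inE ts; lia.
  move=> /(mem_put w1 y0) /orP[/eqP->//|ta] tx; have := bx t.
  by rewrite inE ta orbT; lia.
have E3 : below s z b1 = y.
  apply: below_eq => // [| |t]; first by lia.
    by rewrite inE put_self_or_virtual ?orbT // y0.
  have bz : t \in s :: a -> t < z -> t <= y.
    by move=> ta tz; have := below_max ta tz; rewrite -/z'; lia.
  rewrite inE => /orP[ts|]; first by apply: bz; rewrite inE ts.
  by move=> /(mem_put wa y0) /orP[/eqP->//|ta]; apply: bz; rewrite inE ta orbT.
have E : b2 = a1.
  apply: (wf_row_ext v2 w1) => d ds.
  have := count_put wa z0 ds; have := count_put wa y0 ds.
  have := count_put v1 z0 ds.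
  by rewrite E3 E1 -/z' -/a1 -/b1 -/b2; lia.
have E4 : below s x b2 = y'.
  rewrite E; symmetry; apply: below_shrink; rewrite (ltnW yx) andbT.
  by apply: leq_ltn_trans z'y; apply: below_le.
split; last by rewrite E1 E3 E4 E2 z'y.
apply: (wf_row_ext (wf_put _ _ _) (wf_put _ _ _)) => d ds.
have := count_put v2 x0 ds; have := count_put w2 x0 ds.
have := count_put w1 y0 ds.
by rewrite E4 -/x' E2 E -/y' -/a2; lia.
Qed.

(** * Knuth moves in all rows *)

Arguments climb : simpl never.

(** The last letter of w enters first: a row is sorted, and deletions empty
    it from its right end. *)
Fixpoint climbs (w : seq nat) (M : seq (seq nat)) : seq (seq nat) * seq nat :=
  if w is c :: t then
    ((climb c (climbs t M).1).1, (climb c (climbs t M).1).2 :: (climbs t M).2)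
  else (M, [::]).

Lemma size_climbs w M : size (climbs w M).1 = size M.
Proof. by elim: w => //= c t IH; rewrite size_climb. Qed.

Lemma size_climbs_depths w M : size (climbs w M).2 = size w.
Proof. by elim: w => //= c t ->. Qed.

Lemma wf_climbs w M : wf M -> wf (climbs w M).1.
Proof. by move=> wM; elim: w => //= c t IH; apply: wf_climb. Qed.

(** An elementary Knuth move on three letters with y < x and y <= z, the
    letters being read from right to left. *)
Definition knuth (x y z : nat) : seq nat :=
  if z < x then [:: y; x; z] else [:: x; z; y].

Lemma knuthS x y z : knuth x.+1 y.+1 z.+1 = map S (knuth x y z).
Proof. by rewrite /knuth ltnS; case: ifP. Qed.

(** Since no letter is zero, a row deals with all of them before the rows
    above are considered. *)
Lemma climbs_cons w a P : all (leq 1) w ->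
  climbs w (a :: P) =
    let: (b, v) := foldr (fun c bv => (put (size P).+1 c bv.1,
           below (size P).+1 c bv.1 :: bv.2)) (a, [::]) w in
    (b :: (climbs v P).1, map S (climbs v P).2).
Proof.
elim: w => //= c t IH /andP[c0 t0]; rewrite IH //.
by case: foldr => b v /=; rewrite climb_cons // size_climbs.
Qed.

(** An elementary move on the letters entering a row is passed on as an
    elementary move on the letters leaving it, until y becomes zero. From
    there on two letters are left, whose order does not change, and the order
    of their depths, which selects the move, is that of the letters by
    [climb_weak] and [climb_strict]. *)
Lemma climbs_knuth M x y z : wf M -> y < x -> y <= z -> x <= (size M).+1 ->
  z <= (size M).+1 ->
  let M1 := (climb z M).1 in
  let M2 := (climb y M1).1 in
  climbs (knuth x y z) M =
    ((climb x M2).1, knuth (climb x M2).2 (climb y M1).2 (climb z M).2).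
Proof.
elim: M x y z => [|a P IH] x y z wM yx yz xN zN M1 M2.
  have y0 : y = 0 by move: xN => /=; lia.
  have x1 : x = 1 by move: xN => /=; lia.
  rewrite /M2 /M1 {M1 M2} y0 x1.
  by move: zN => /=; case: z {yz yx xN} => [|[]].
case: (posnP y) => [y0|y0].
  rewrite /M2 /M1 y0 !climb0 /knuth /=.
  case: ifP => zx.
    by rewrite climb_strict ?zx /= ?climb0.
  by rewrite ltnNge climb_weak /= ?climb0 // leqNgt zx.
have x0 : 0 < x by lia.
have z0 : 0 < z by lia.
case/andP: wM => wa wP.
have lt1 c b : 0 < c -> c <= (size P).+2 -> below (size P).+1 c b <= (size P).+1.
  by move=> c0 cs; have := below_lt (size P).+1 b c0; lia.
rewrite climbs_cons; last by rewrite /knuth; case: ifP; rewrite /= ?x0 ?y0 ?z0.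
rewrite /M2 /M1 !climb_cons // !size_climb knuthS.
set a1 := put _ z a; set z' := below _ z a; set y' := below _ y a1.
set x' := below _ x _.
have z'y : y' <= z'.
  apply: below_le => // t; rewrite inE => /orP[ts|/(mem_put wa z0)/orP[/eqP->|ta]] ty.
  - by apply: below_max; rewrite ?inE ?ts //; lia.
  - by lia.
  by apply: below_max; rewrite ?inE ?ta ?orbT //; lia.
have y'x : y' < x'.
  have y'y := below_lt (size P).+1 a1 y0.
  apply: leq_trans y'y _; apply: below_max => //; apply: put_self_or_virtual.
    exact: wf_put.
  by move: xN => /=; lia.
have := IH x' y' z' wP y'x z'y (lt1 _ _ x0 xN) (lt1 _ _ z0 zN); cbv zeta => {}IH.
have [zx|xz] := ltnP z x.
  have [|||E1 E2 E3 E4] := @row_knuth_lt (size P).+1 a x y z; rewrite ?y0 ?zx //.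
  rewrite {1}/knuth zx [foldr _ _ _]/= -/a1 -/z' E3; cbv beta iota.
  have -> : [:: below (size P).+1 y (put (size P).+1 x a1);
                below (size P).+1 x a1; z'] = knuth x' y' z'.
    by rewrite /knuth E2 -E1 -/x' {2}/x' E1 E4.
  by rewrite IH.
have [||E1 E2] := @row_knuth_le (size P).+1 a x y z wa; rewrite ?y0 ?xz //.
rewrite {1}/knuth ltnNge xz [foldr _ _ _]/= E1; cbv beta iota.
set b1 := put _ y a; set b2 := put _ z b1.
have -> : [:: below (size P).+1 x b2; below (size P).+1 z b1;
              below (size P).+1 y a] = knuth x' y' z'.
  by rewrite /knuth; move: E2; rewrite -/a1 -/z' -/y' -/x'; case: ifP => _ [-> -> ->].
by rewrite IH.
Qed.

(** Elementary Knuth moves along the word x, y, t, from left to right. The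
    letter x exceeds y and is read last; the letter that x can replace in the
    row y, t comes to the end of the word and is read first. *)
Fixpoint exchange (x y : nat) (t : seq nat) : seq nat :=
  if t is z :: t' then
    if z < x then y :: exchange x z t' else x :: exchange z y t'
  else [:: x; y].

(** Each elementary move is made on the letters and on their depths by the
    same rule, although the branches of the rule may differ. *)
Lemma climbs_exchange M x y t :
  wf M -> y < x <= (size M).+1 -> sorted leq (y :: t) ->
  all (fun z => z <= (size M).+1) t ->
  climbs (exchange x y t) M =
    ((climbs [:: x, y & t] M).1,
     exchange (climb x (climbs (y :: t) M).1).2 (climb y (climbs t M).1).2 (climbs t M).2).
Proof.
move=> wM; elim: t x y => [|z t IH] x y /andP[yx xN] //.
rewrite [sorted _ _]/= => /andP[yz zt] /andP[zN tN].
have := @climbs_knuth (climbs t M).1 x y z (wf_climbs t wM) yx yz.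
rewrite size_climbs; move=> /(_ xN zN); cbv zeta; rewrite /knuth /=.
set dz := (climb z (climbs t M).1).2; set M1 := (climb z (climbs t M).1).1.
set dy := (climb y M1).2; set M2 := (climb y M1).1; set dx := (climb x M2).2.
case: (ltnP z x) => zx /=.
  have zxN : z < x <= (size M).+1 by rewrite zx.
  rewrite (IH x z zxN zt tN) /=.
  by case: ifP => _ [-> -> ->] // ->.
have yzN : y < z <= (size M).+1 by rewrite zN andbT; lia.
have yt : sorted leq (y :: t).
  case: t {IH tN M1 dz dy M2 dx} zt => //= u t /andP[zu ->].
  by rewrite (leq_trans yz).
rewrite (IH z y yzN yt tN) /=.
by case: ifP => _ [-> -> ->] // ->.
Qed.

Lemma exchange_spec x y t : y < x -> sorted leq (y :: t) ->
  exists w p, [/\ exchange x y t = rcons w p, sorted leq w,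
    perm_eq (p :: w) [:: x, y & t], (p \in y :: t) && (p < x)
    & forall u, u \in y :: t -> u < x -> u <= p].
Proof.
elim: t x y => [|z t IH] x y yx srt.
  exists [:: x], y; split=> //; rewrite ?inE ?eqxx ?yx //.
    by apply/permP => f /=; lia.
  by move=> u; rewrite inE => /eqP->.
have /= /andP[yz zt] := srt.
have yall : all (leq y) (z :: t) := order_path_min leq_trans srt.
rewrite /=; case: (ltnP z x) => zx.
  have [w [p [-> sw pw /andP[pin px] pmax]]] := IH x z zx zt.
  exists (y :: w), p; split=> //.
  - rewrite /= (path_sortedE leq_trans) sw andbT; apply/allP => u uw.
    have : u \in p :: w by rewrite inE uw orbT.
    rewrite (perm_mem pw) inE => /orP[/eqP->|]; first by lia.
    by move/allP: yall; apply.
  - apply/permP => f; have /permP/(_ f) /= Hf := pw.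
    by rewrite addnCA Hf addnCA.
  - by rewrite inE pin orbT px.
  move=> u; rewrite inE => /orP[/eqP->|/pmax//] _.
  by move/allP: yall; apply.
have zall : all (leq z) t := order_path_min leq_trans zt.
have yt : sorted leq (y :: t).
  rewrite /= (path_sortedE leq_trans) (path_sorted zt) andbT.
  by case/andP: yall.
have yz' : y < z by lia.
have [w [p [-> sw pw /andP[pin px] pmax]]] := IH z y yz' yt.
have py : p = y.
  move: pin; rewrite inE => /orP[/eqP//|/(allP zall)]; lia.
exists (x :: w), p; split=> //.
- rewrite /= (path_sortedE leq_trans) sw andbT; apply/allP => u uw.
  have : u \in z :: t.
    have : perm_eq w (z :: t).
      rewrite -(perm_cons y) -{1}py; apply: perm_trans pw _.
      by apply/permP => f /=; rewrite addnCA.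
    by move/perm_mem <-.
  rewrite inE => /orP[/eqP->//|/(allP zall)]; lia.
- apply/permP => f; have /permP/(_ f) /= Hf := pw.
  by rewrite addnCA Hf [f z + _]addnCA.
- by rewrite py inE eqxx.
move=> u; rewrite py !inE => /or3P[/eqP->//|/eqP->|/(allP zall)]; lia.
Qed.

(** * Duality of multisegments *)

Lemma climbs_rcons w p P : climbs (rcons w p) P =
  ((climbs w (climb p P).1).1, rcons (climbs w (climb p P).1).2 (climb p P).2).
Proof. by elim: w => //= c t ->. Qed.

Lemma climbs_depth_le w P : wf P -> all (fun c => c <= (size P).+1) w ->
  all (fun d => d <= (size P).+1) (climbs w P).2.
Proof.
move=> wP; elim: w => //= c t IH /andP[cN tN].
rewrite IH // andbT -[in X in _ <= X](size_climbs t P).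
by rewrite depth_le_top ?size_climbs ?wf_climbs.
Qed.

(** Virtual letters leave the rows above unchanged, and their depths are the
    extreme values 0 and size P + 1, which are virtual as well. *)
Lemma climbs_interior w P : wf P -> all (fun c => c <= (size P).+1) w ->
  climbs [seq c <- w | interior (size P).+1 c] P =
  ((climbs w P).1, [seq d <- (climbs w P).2 | interior (size P).+1 d]).
Proof.
move=> wP; elim: w => //= c t IH /andP[cN tN].
have wt := wf_climbs t wP.
have := depth_eq0 c (climbs t P).1.
have := @depth_le c (climbs t P).1.
have := climb_top wt.
rewrite size_climbs /interior; case: (posnP c) => [->|c0] ct d1 d2 /=.
  by rewrite climb0 /= IH.
move: cN; rewrite leq_eqVlt => /orP[/eqP E|cN].
  by rewrite E ct ltnn andbF /= IH.
rewrite cN /= IH // lt0n d2 /=.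
by rewrite ltnS d1.
Qed.

Lemma climbs_sorted w M : wf M -> sorted leq w -> sorted leq (climbs w M).2.
Proof.
move=> wM; elim: w => // c [|c2 t] //= IH /andP[cc2 st].
by rewrite climb_weak ?wf_climbs //=; apply: IH.
Qed.

(** Turns a list of depths into the list of terminating row numbers, in order
    of occurrence. *)
Definition mirror (N : nat) (ds : seq nat) : seq nat := rev [seq N - d | d <- ds].

Lemma mirrorK N ds : all (fun d => d <= N) ds -> mirror N (mirror N ds) = ds.
Proof.
move=> /allP dN; rewrite /mirror map_rev revK -map_comp -[RHS]map_id.
by apply/eq_in_map => d /dN /= dN'; rewrite subKn.
Qed.

Lemma mirror_interior N ds : all (fun d => d <= N) ds ->
  mirror N [seq d <- ds | interior N d] =
  [seq k <- mirror N ds | interior N k].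
Proof.
move=> /allP dN; rewrite /mirror filter_rev filter_map; congr (rev [seq _ | _ <- _]).
by apply/eq_in_filter => d /dN /= dN'; rewrite /interior; lia.
Qed.

Lemma mem_mirror N ds k : k \in mirror N ds -> exists2 d, d \in ds & k = N - d.
Proof. by rewrite mem_rev => /mapP. Qed.

Lemma mirror_sorted N ds : sorted leq ds -> sorted leq (mirror N ds).
Proof.
move=> sd; rewrite /mirror rev_sorted sorted_map.
by apply: sub_sorted sd => x y /=; lia.
Qed.

(** The fuel n is the number of rows, which the climbing letters do not
    change. *)
Fixpoint dual_rec (n : nat) (M : seq (seq nat)) : seq (seq nat) :=
  if n is n'.+1 then
    if M is a :: P then mirror (size M) (climbs a P).2 :: dual_rec n' (climbs a P).1
    else [::]
  else [::].

Definition dual (M : seq (seq nat)) : seq (seq nat) := dual_rec (size M) M.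

Lemma dual_cons a P :
  dual (a :: P) = mirror (size P).+1 (climbs a P).2 :: dual (climbs a P).1.
Proof. by rewrite /dual /= size_climbs. Qed.

Lemma size_dual M : size (dual M) = size M.
Proof.
rewrite /dual; move En : (size M) => n.
elim: n M En => [|n IH] [|a P] //= [E]; by rewrite IH // size_climbs.
Qed.

Lemma wf_row_letters N a : wf_row N a -> all (fun c => c <= N) a.
Proof. by case/andP=> _; apply: sub_all => c /andP[_ /ltnW]. Qed.

Lemma wf_mirror_climbs a P : wf P -> wf_row (size P).+1 a ->
  wf_row (size P).+1 (mirror (size P).+1 (climbs a P).2).
Proof.
move=> wP wa; have /andP[sa ia] := wa; apply/andP; split.
  exact/mirror_sorted/climbs_sorted.
have := climbs_interior wP (wf_row_letters wa).
rewrite (all_filterP ia) [LHS]surjective_pairing => - [{1}->].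
rewrite mirror_interior; first exact: filter_all.
exact: climbs_depth_le (wf_row_letters wa).
Qed.

Lemma wf_dual M : wf M -> wf (dual M).
Proof.
move En : (size M) => n; elim: n M En => [|n IH] [|a P] // [E] /andP[wa wP].
rewrite dual_cons /= size_dual size_climbs wf_mirror_climbs // IH ?size_climbs //.
exact: wf_climbs.
Qed.

Lemma count_filter_interior s w d : interior s d ->
  count_mem d [seq x <- w | interior s x] = count_mem d w.
Proof.
move=> ds; rewrite count_filter; apply: eq_count => t /=.
by case: eqP => // ->; rewrite ds.
Qed.

(** The words u and u' are rows to which virtual entries have been added;
    exchanging c and p between them is then the same as letting c enter the
    row. *)
Lemma row_exchange N c p u u' : 0 < c <= N -> p < c -> p \in u ->
  (forall t, t \in u -> t < c -> t <= p) -> perm_eq (p :: u') (c :: u) ->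
  let a := [seq t <- u | interior N t] in
  let a' := [seq t <- u' | interior N t] in
  wf_row N a -> wf_row N a' -> below N c a = p /\ put N c a = a'.
Proof.
move=> /andP[c0 cN] pc pu pmax perm a a' wa wa'.
have E : below N c a = p.
  apply: below_eq => // [|t].
    rewrite inE; case: (posnP p) => //= p0.
    by rewrite inE mem_filter pu /interior p0 (leq_trans pc cN) orbT.
  rewrite inE mem_filter => /orP[/eqP-> Nc|/andP[_]]; last exact: pmax.
  by lia.
split=> //; apply: (wf_row_ext (wf_put _ _ _) wa') => d ds.
have := count_put wa c0 ds; rewrite E.
rewrite !count_filter_interior //.
have /permP/(_ (pred1 d)) /= := perm; rewrite ![d == _]eq_sym.
lia.
Qed.

(** The letter c and the terminating row number play symmetric roles. The
    extreme letters 0 and size M + 1 do nothing and correspond to each other;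
    otherwise c is exchanged with an entry of the bottom row, while the
    terminating row number is exchanged in the bottom row of the dual. *)
Theorem climb_dual M c : wf M -> c <= (size M).+1 ->
  climb ((size M).+1 - (climb c M).2) (dual (climb c M).1) =
    (dual M, (size M).+1 - c).
Proof.
move En : (size M) => n; elim: n M En c => [|n IH] M En c wM cN.
  case: M En wM => // _ _; case: c cN => [|[]] //.
case: M En wM => // a P [En] wM; subst n.
have /andP[wa wP] := wM; rewrite /= in wa.
case: (posnP c) => [->|c0].
  by rewrite climb0 !subn0; have := climb_top (wf_dual wM); rewrite size_dual /=.
move: cN; rewrite leq_eqVlt => /orP[/eqP->|cN].
  have := climb_top wM; rewrite /= => -> /=.
  by rewrite subnn climb0.
have /andP[sa ia] := wa.
have aN := wf_row_letters wa.
(* With a virtual zero in front, the word always has a letter smaller than c;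
   the virtual letter at its end makes room for the case where c is the row
   number. *)
pose t := rcons a (size P).+1.
have tN : all (fun z => z <= (size P).+1) t by rewrite all_rcons leqnn.
have st : sorted leq (0 :: t).
  rewrite /= path_sortedE; last exact: leq_trans.
  rewrite all_predT /t; case: (a) sa aN => //= y r sy /andP[yN rN].
  rewrite rcons_path sy /=.
  by have := mem_last y r; rewrite inE => /orP[/eqP->|/(allP rN)].
have fa : [seq x <- 0 :: t | interior (size P).+1 x] = a.
  by rewrite /= filter_rcons {1}/interior ltnn andbF (all_filterP ia).
have c0N : 0 < c <= (size P).+1 by rewrite c0.
have := climbs_exchange wP c0N st tN.
have [w [p [-> sw pw /andP[pin pc] pmax]]] := exchange_spec c0 st.
rewrite climbs_rcons; set Q := (climb p P).1; set d := (climb p P).2.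
rewrite /= climb0; set Pa := (climbs t P).1; set D := (climbs t P).2.
have wPa : wf Pa by apply: wf_climbs.
have sPa : size Pa = size P by rewrite size_climbs.
set d2 := (climb c Pa).2 => - [E1 E2].
have d20 : 0 < d2 by rewrite lt0n depth_eq0 -lt0n.
have sD : sorted leq (0 :: D).
  rewrite /= path_sortedE; last exact: leq_trans.
  by rewrite all_predT climbs_sorted //; apply: path_sorted st.
(* The depths of the two words differ by the exchange that has been made on
   the letters, now applied to the depth d2 of c, which enters last in one of
   them. *)
have [v [q [E3 sv pv /andP[qin qd2] qmax]]] := exchange_spec d20 sD.
move: E2; rewrite E3 => /rcons_inj [E2 E4].
rewrite -{}E2 -{}E4 in sv pv qin qd2 qmax; clear E3 v q.
have wN : all (fun z => z <= (size P).+1) w.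
  apply/allP => z zw; have : z \in p :: w by rewrite inE zw orbT.
  rewrite (perm_mem pw) !inE => /or3P[/eqP->//|/eqP->//|].
  by move/(allP tN).
have sQ : size Q = size P by rewrite size_climb.
have wQ : wf Q by apply: wf_climb.
have ww : wf_row (size P).+1 [seq z <- w | interior (size P).+1 z].
  by rewrite /wf_row filter_all sorted_filter //; exact: leq_trans.
have [||EB EP] := row_exchange c0N pc pin pmax pw; rewrite ?fa //.
rewrite fa in EB EP.
rewrite climb_cons // EB EP -/Q -/d /=.
have wN' : all (fun z => z <= (size Q).+1) w by rewrite sQ.
have DN : all (fun z => z <= (size P).+1) (0 :: D) by apply: climbs_depth_le.
have DqN : all (fun z => z <= (size P).+1) (climbs w Q).2.
  by have := climbs_depth_le wQ wN'; rewrite sQ.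
have Ea : climbs a P = (Pa, [seq z <- 0 :: D | interior (size P).+1 z]).
  by have := @climbs_interior (0 :: t) P wP tN; rewrite fa /= climb0.
have Eq : climbs [seq z <- w | interior (size P).+1 z] Q =
    ((climb c Pa).1, [seq z <- (climbs w Q).2 | interior (size P).+1 z]).
  by have := climbs_interior wQ wN'; rewrite sQ E1.
rewrite !dual_cons Ea Eq /= sQ !mirror_interior //.
have d2N : d2 <= (size P).+1.
  by have := @depth_le_top c Pa wPa; rewrite sPa; apply.
have dN : d < (size P).+1 := leq_trans qd2 d2N.
have k0 : 0 < (size P).+1 - d by rewrite subn_gt0.
have sub2 x : (size P).+2 - x.+1 = (size P).+1 - x by [].
have d2q : d2 \in (climbs w Q).2.
  have : d2 \in d :: (climbs w Q).2 by rewrite (perm_mem pv) inE eqxx.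
  by rewrite inE => /orP[/eqP d2d|//]; move: qd2; rewrite d2d ltnn.
(* Passing from depths to terminating row numbers reverses the order, so that
   the inverse of an exchange of depths becomes an exchange again. *)
pose N := (size P).+1; pose K := mirror N (climbs w Q).2.
have h1 : 0 < N - d <= N by rewrite k0 leq_subr.
have h2 : N - d2 < N - d by rewrite ltn_sub2l.
have h3 : N - d2 \in K by rewrite mem_rev map_f.
have h4 x : x \in K -> x < N - d -> x <= N - d2.
  move=> /mem_mirror [y yin ->].
  have : y \in d :: (climbs w Q).2 by rewrite inE yin orbT.
  rewrite (perm_mem pv) inE => /orP[/eqP->//|yD] lt1.
  apply: leq_sub2l; rewrite leqNgt; apply/negP => yd2.
  have := qmax y yD yd2; apply/negP; rewrite -ltnNge.
  by move: lt1; clear; lia.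
have h5 : perm_eq (N - d2 :: mirror N (0 :: D)) (N - d :: K).
  have : perm_eq [seq N - x | x <- [:: d2, 0 & D]]
                 [seq N - x | x <- d :: (climbs w Q).2].
    by apply: perm_map; rewrite perm_sym.
  rewrite !map_cons => /permP H; apply/permP => f.
  by have := H f; rewrite /= /K !count_rev.
have wfi D' : sorted leq D' -> wf_row N [seq k <- mirror N D' | interior N k].
  move=> sD'; rewrite /wf_row filter_all sorted_filter ?mirror_sorted //.
  exact: leq_trans.
have [EB2 EP2] := row_exchange h1 h2 h3 h4 h5 (wfi _ sv) (wfi _ sD).
rewrite sub2 -/N -/K climb_cons // size_dual size_climb sPa -/N EB2 EP2.
have := IH Pa sPa c wPa cN; rewrite -/d2 -/N => -> /=.
rewrite /mirror /= rev_cons filter_rcons subn0 {1}/interior ltnn andbF.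
by rewrite subSn.
Qed.

(** [climb_dual] undoes the last letter first, hence the reversal in
    [mirror]. *)
Lemma climbs_dual w P : wf P -> all (fun c => c <= (size P).+1) w ->
  climbs (mirror (size P).+1 (climbs w P).2) (dual (climbs w P).1) =
    (dual P, mirror (size P).+1 w).
Proof.
move=> wP; elim: w => //= c t IH /andP[cN tN].
rewrite /mirror !map_cons !rev_cons climbs_rcons.
have wt := wf_climbs t wP.
have := climb_dual wt; rewrite size_climbs => /(_ c cN) -> /=.
by rewrite -/(mirror _ _) IH.
Qed.

Theorem dualK M : wf M -> dual (dual M) = M.
Proof.
move En : (size M) => n; elim: n M En => [|n IH] [|a P] // [E] /andP[wa wP].
have aN := wf_row_letters wa.
rewrite dual_cons dual_cons size_dual size_climbs climbs_dual //= mirrorK //.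
by rewrite IH.
Qed.

(** * Column strictness and the lattice condition under duality *)

Definition row_at (M : seq (seq nat)) (s : nat) : seq nat := nth [::] (rev M) s.-1.

Lemma row_at_cons a P s : 0 < s <= size P -> row_at (a :: P) s = row_at P s.
Proof. by case: s => // s /= sP; rewrite /row_at rev_cons nth_rcons size_rev sP. Qed.

Lemma row_at_head a P : row_at (a :: P) (size P).+1 = a.
Proof. by rewrite /row_at rev_cons nth_rcons size_rev ltnn eqxx. Qed.

Lemma count_sub_in (p q : pred nat) s :
  (forall x, x \in s -> p x -> q x) -> count p s <= count q s.
Proof.
elim: s => //= x s IH H; apply: leq_add; last first.
  by apply: IH => y ys; apply: H; rewrite inE ys orbT.
by case: (p x) (H x (mem_head x s)) => // ->.
Qed.

Lemma count_put_pred s c a (p : pred nat) : wf_row s a -> 0 < c <= s ->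
  count p (put s c a) + ((0 < below s c a) && p (below s c a)) =
  count p a + ((c < s) && p c).
Proof.
move=> /andP[_ /allP aint] /andP[c0 cs].
have blt := below_lt s a c0.
have bin := below_in s c a.
rewrite /put count_sort count_filter.
have -> : count (predI p (interior s)) (c :: rem (below s c a) a) =
  ((c < s) && p c) + count p (rem (below s c a) a).
  rewrite /= {1}/interior c0 andbC; congr (_ + _); apply: eq_in_count => x.
  by move/mem_rem/aint => /= ->; rewrite andbT.
rewrite count_rem.
have -> : (below s c a \in a) = (0 < below s c a).
  apply/idP/idP => [/aint/andP[]//|b0].
  by move: bin; rewrite !inE => /or3P[/eqP|/eqP|//]; lia.
case E : (_ && p (below s c a)); last by rewrite addn0 subn0 addnC.
rewrite -addnA subnK; first by rewrite addnC.
case/andP: E => b0 pb; rewrite -has_count; apply/hasP; exists (below s c a) => //.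
by move: bin; rewrite !inE => /or3P[/eqP|/eqP|//]; lia.
Qed.

(** Column strictness of two consecutive rows with interior entries a and b,
    when the inner shape is longer by x in the upper row: for each k, the
    cells with entries at most k in the lower row lie below cells with
    entries less than k. *)
Definition colstrict (i x : nat) (a b : seq nat) : Prop :=
  forall k, k <= i -> count (fun e => e <= k) b <= count (fun e => e < k) a + x.

(** A letter c enters the lower row and replaces c1, which enters the upper
    row and replaces c2. The counts that are compared in [colstrict] change
    only between c2 and c1 and between c1 and c; on each of these ranges one
    of the two rows has no entries, so that the extreme value of the
    difference is reached outside them or at c1. *)
Section TwoRows.

Variables (i c : nat) (a b : seq nat).
Hypotheses (wa : wf_row i a) (wb : wf_row i.+1 b) (cb : 0 < c <= i.+1).

Let c1 := below i.+1 c b.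
Let b1 := put i.+1 c b.
Let F k := count (fun e => e <= k) b.
Let F1 k := count (fun e => e <= k) b1.

Lemma lower_countE k : k <= i -> F1 k + ((0 < c1) && (c1 <= k)) = F k + (c <= k).
Proof.
move=> ki; rewrite /F1 count_put_pred // -/c1 -/(F k); congr (_ + nat_of_bool _).
by case/andP: cb; lia.
Qed.

Lemma lower_count_gap k : k < c -> F k <= F c1.
Proof.
move=> kc; apply: count_sub_in => x xb /= xk.
by apply: below_max; rewrite ?inE ?xb ?orbT //; lia.
Qed.

Lemma lower_count_lt k : 0 < c1 -> k < c1 -> F k < F c1.
Proof.
move=> c10 kc1.
have c1b : c1 \in b.
  have := below_in i.+1 c b; have := below_lt i.+1 b (proj1 (andP cb)).
  by rewrite -/c1 !inE; case/andP: cb => _ ci lt /or3P[/eqP|/eqP|//]; lia.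
have : count (fun e => e <= k) b + count (pred1 c1) b <= count (fun e => e <= c1) b.
  rewrite -count_predUI (@eq_count _ (predI _ _) pred0) ?count_pred0 ?addn0.
    by apply: sub_count => x /= /orP[|/eqP->//]; lia.
  by move=> x; apply/negP => /andP[/= xk /eqP xc]; move: kc1; rewrite -xc ltnNge xk.
move: c1b; rewrite mem_count => c1b H; apply: leq_trans H.
by rewrite -addn1 leq_add2l.
Qed.

Lemma colstrict_new x : c1 = 0 -> colstrict i x a b <-> colstrict i x.+1 a b1.
Proof.
move=> c10; split=> H k ki; have := H k ki; have := lower_countE ki;
  rewrite -/(F k) -/(F1 k) c10 /=.
  lia.
case: (leqP c k) => [|kc]; first lia.
have := lower_count_gap kc; rewrite c10.
suff -> : F 0 = 0 by lia.
apply/eqP; rewrite -leqn0 leqNgt -has_count; apply/hasPn => y /=.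
by case/andP: wb => _ /allP H' /H'/andP[]; lia.
Qed.

Hypothesis c10 : 0 < c1.
Let c2 := below i c1 a.
Let a1 := put i c1 a.
Let G k := count (fun e => e < k) a.
Let G1 k := count (fun e => e < k) a1.

Lemma lower_exit_le : c1 <= i.
Proof. by case/andP: cb => c0 ci; have := below_lt i.+1 b c0; rewrite -/c1; lia. Qed.

Lemma upper_countE k : k <= i -> G1 k + ((0 < c2) && (c2 < k)) = G k + (c1 < k).
Proof.
move=> ki; have ci := lower_exit_le.
rewrite /G1 count_put_pred ?c10 // -/c2 -/(G k); congr (_ + nat_of_bool _).
by lia.
Qed.

Lemma upper_count_gap k : c2 < k -> G c1 <= G k.
Proof.
move=> kc; apply: count_sub_in => x xa /= xk.
apply: leq_ltn_trans kc; apply: below_max => //; by rewrite inE xa orbT.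
Qed.

Lemma upper_count0 : c2 = 0 -> G c1 = 0.
Proof.
move=> c20; apply/eqP; rewrite -leqn0 leqNgt -has_count; apply/hasPn => y /= ya.
case/andP: wa => _ /allP /(_ y ya) /andP[y0 _]; rewrite -leqNgt leqNgt.
apply/negP => yc; have := @below_max i c1 a y; rewrite -/c2 inE ya orbT.
by move=> /(_ isT yc); lia.
Qed.

Lemma colstrict_pass x : 0 < c2 -> colstrict i x a b <-> colstrict i x a1 b1.
Proof.
move=> c20; have c21 : c2 < c1 by apply: below_lt.
have Fc1 := lower_countE lower_exit_le; have Gc1 := upper_countE lower_exit_le.
have c1c : c1 < c by apply: below_lt; case/andP: cb.
split=> H k ki; have := H k ki; have := H c1 lower_exit_le.
  have := lower_countE ki; have := upper_countE ki.
  have := @lower_count_lt k c10; have := @upper_count_gap k.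
  rewrite -/(F k) -/(F1 k) -/(G k) -/(G1 k) -/(F c1) -/(G c1).
  move: Fc1 Gc1; rewrite c10 c20 /=; clear -c21 c1c; lia.
have := lower_countE ki; have := upper_countE ki.
have := @lower_count_gap k; have := @upper_count_gap k.
rewrite -/(F k) -/(F1 k) -/(G k) -/(G1 k) -/(F1 c1) -/(G1 c1).
move: Fc1 Gc1; rewrite c10 c20 /=; clear -c21 c1c; lia.
Qed.

Lemma colstrict_stop x : c2 = 0 ->
  colstrict i x a b <-> 0 < x /\ colstrict i x.-1 a1 b1.
Proof.
move=> c20.
have Fc1 := lower_countE lower_exit_le.
have Gc1 := upper_countE lower_exit_le; have Gc0 := upper_count0 c20.
have c1c : c1 < c by apply: below_lt; case/andP: cb.
split=> [H|[x0 H]].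
  have := H c1 lower_exit_le; rewrite -/(F c1) -/(G c1) Gc0 => Fx.
  have x0 : 0 < x.
    by have := @lower_count_lt 0 c10 c10; move: Fx; clear; lia.
  split=> // k ki; have := H k ki.
  have := lower_countE ki; have := upper_countE ki.
  have := @lower_count_lt k c10; have := @upper_count_gap k.
  rewrite -/(F k) -/(F1 k) -/(G k) -/(G1 k).
  move: Fc1 Gc1; rewrite c10 c20 /=; clear -Fx x0 c1c; lia.
move=> k ki; have := H k ki; have := H c1 lower_exit_le.
have := lower_countE ki; have := upper_countE ki; have := @lower_count_gap k.
rewrite -/(F k) -/(F1 k) -/(G k) -/(G1 k) -/(F1 c1) -/(G1 c1).
move: Fc1 Gc1; rewrite c10 c20 /= Gc0; clear -x0 c1c c10; lia.
Qed.

End TwoRows.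

Definition strict_rows (i x : nat) (M : seq (seq nat)) : Prop :=
  colstrict i x (row_at M i) (row_at M i.+1).

Lemma strict_rows_cons i x a P : 0 < i < size P ->
  strict_rows i x (a :: P) = strict_rows i x P.
Proof. by move=> /andP[i0 iP]; rewrite /strict_rows !row_at_cons ?i0 ?(ltnW iP). Qed.

(** With k the terminating row number, the slack x changes only when row i or
    row i + 1 loses a zero, that is when k is i or i + 1. *)
Lemma strict_rows_climb M c i x : wf M -> 0 < i < size M -> c <= (size M).+1 ->
  let k := (size M).+1 - (climb c M).2 in
  let Q := (climb c M).1 in
  strict_rows i x M <->
    (if k == i then 0 < x /\ strict_rows i x.-1 Q
     else if k == i.+1 then strict_rows i x.+1 Q else strict_rows i x Q).
Proof.
elim: M c x => [|b P IH] c x wM iM cN; cbv zeta; first by rewrite ltn0 andbF in iM.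
case: (posnP c) => [->|c0].
  case/andP: iM => _ iM; rewrite climb0 subn0.
  by rewrite gtn_eqF ?(ltnW iM : i < (size _).+1) // gtn_eqF.
move: cN; rewrite leq_eqVlt => /orP[/eqP->|cN].
  rewrite climb_top // subnn /=; case/andP: iM => i0 _.
  by rewrite ltn_eqF.
have /andP[wb wP] : wf_row (size P).+1 b && wf P := wM.
have /andP[i0 iP] := iM.
have lt1 := below_lt (size P).+1 b c0.
rewrite climb_cons //= subSS.
move: iP; rewrite ltnS leq_eqVlt => /orP[/eqP E|iP]; last first.
  have iP' : 0 < i < size P by rewrite i0.
  rewrite !strict_rows_cons ?size_climb //; apply: IH => //.
  by move: cN lt1 => /=; clear; lia.
case: P E wb wP lt1 cN {IH iM wM} => [|a P] E; first by rewrite E in i0.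
have Ei : i = (size P).+1 := E.
rewrite /= -Ei => wb /andP[wa wP] lt1 cN.
have hd b' Q : size Q = size P -> row_at (b' :: Q) i = b'.
  by rewrite Ei => <-; rewrite row_at_head.
have hd2 c' a' Q : size Q = size P -> row_at [:: c', a' & Q] i.+1 = c'.
  by rewrite Ei => <-; rewrite (row_at_head c' (a' :: Q)).
have hd1 c' a' Q : size Q = size P -> row_at [:: c', a' & Q] i = a'.
  by move=> sQ; rewrite row_at_cons ?hd //= sQ Ei ltnSn.
have cb : 0 < c <= i.+1 by rewrite c0 -ltnS.
rewrite /strict_rows hd1 // hd2 //.
case: (posnP (below i.+1 c b)) => [c10|c10].
  rewrite c10 climb0 subn0 eqxx gtn_eqF // hd1 // hd2 //.
  exact: colstrict_new.
rewrite climb_cons //= -Ei subSS.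
set Q := (climb _ P).1; have sQ : size Q = size P by rewrite size_climb.
rewrite hd1 // hd2 //.
case: (posnP (below i (below i.+1 c b) a)) => [c20|c20].
  rewrite c20 climb0 /= subn0 eqxx; exact: colstrict_stop.
have := depth_eq0 (below i (below i.+1 c b) a) P.
rewrite [RHS]gtn_eqF //; case: (climb _ P).2 => // d _.
rewrite !ltn_eqF ?ltn_subrL //; first exact: colstrict_pass.
by rewrite ltnS leq_subr.
Qed.

(** Terminating row numbers weakly increase when letters enter in decreasing
    order, so that all terminations in row i precede those in row i + 1: the
    slack decreases before it increases. *)
Lemma strict_rows_climbs w P i x : wf P -> sorted leq w ->
  all (fun c => c <= (size P).+1) w -> 0 < i < size P ->
  let K := mirror (size P).+1 (climbs w P).2 in
  strict_rows i x P <-> count_mem i K <= x /\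
     strict_rows i (x - count_mem i K + count_mem i.+1 K) (climbs w P).1.
Proof.
move=> wP sw wN iP; rewrite /mirror.
have := climbs_sorted wP sw.
elim: w x sw wN => [|c t IH] x sw; first by rewrite /= subn0 addn0; tauto.
move=> /= /andP[cN tN] sd.
have st := path_sorted sw; have := IH x st tN (path_sorted sd).
have wt := wf_climbs t wP.
have iN : 0 < i < size (climbs t P).1 by rewrite size_climbs.
have cN' : c <= (size (climbs t P).1).+1 by rewrite size_climbs.
have := fun x' => strict_rows_climb x' wt iN cN'; cbv zeta; rewrite size_climbs.
have := order_path_min leq_trans sd.
set d := (climb c _).2; set D := (climbs t P).2 => dD Hc ->.
rewrite !rev_cons -!cats1 !count_cat /=.
set K := rev _ => {IH}.
(* The letters before c terminate in rows at most that of c. *)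
have K0 : (size P).+1 - d = i -> count_mem i.+1 K = 0.
  move=> E; apply/eqP; rewrite -leqn0 leqNgt -has_count; apply/hasPn => y.
  move=> /mem_mirror[d' d'D ->]; apply/eqP => /= E'.
  by move: (allP dD _ d'D) E E'; clear; lia.
case: (eqVneq _ i) (Hc (x - count_mem i K + count_mem i.+1 K)) => [E|ne].
  rewrite K0 // E !addn0 ?eqxx ltn_eqF // => H; rewrite addn1 subnS !addn0.
  split; first by case=> h1 /H[h2 h3]; split=> //; rewrite -subn_gt0.
  case=> h1 h2; split; first exact: ltnW.
  by apply/H; split=> //; rewrite subn_gt0.
case: eqVneq => _ H; rewrite !addn0 ?addn1 ?addnS.
  by split; case=> h1 /H h2.
by split; case=> h1 /H h2.
Qed.

(** The lattice condition for the letters i and i + 1, with x the excess of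
    all letters i over all letters i + 1: in each initial segment of rows,
    the number of letters i + 1 is at most the number of letters i strictly
    above its last row. It is read from the bottom row upwards, by removing
    from the totals the letters of the rows already seen. *)
Fixpoint lattice_at (i x : nat) (D : seq (seq nat)) : Prop :=
  if D is K :: D' then
    size D' < i \/
    count_mem i K <= x /\ lattice_at i (x - count_mem i K + count_mem i.+1 K) D'
  else True.

Lemma lattice_at_small i x D : size D <= i -> lattice_at i x D.
Proof. by case: D => //= K D iD; left. Qed.

(** When the lower of the two rows is emptied, the slack decreases exactly
    with the letters that terminate in row i, and an empty lower row
    satisfies the condition with any slack. *)
Lemma strict_rows_last i x b P : wf (b :: P) -> size P = i -> 0 < i ->
  strict_rows i x (b :: P) <-> count_mem i (mirror i.+1 (climbs b P).2) <= x.
Proof.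
move=> /andP[wb wP] E i0; rewrite /= E in wb.
elim/last_ind: b x P wb wP E => [|t c IH] x P wb wP E.
  split=> // _ k ki; rewrite /strict_rows -E row_at_head; exact: leq0n.
have /andP[sb ib] := wb.
have /andP[ci it] : interior i.+1 c && all (interior i.+1) t by rewrite -all_rcons.
have st : sorted leq t by move: sb; rewrite -cats1 => /cat_sorted2[].
have wt : wf_row i.+1 t by apply/andP.
have tc z : z \in t -> z <= c.
  move=> zt; move: sb; rewrite -rev_sorted rev_rcons /= => /(order_path_min _) H.
  have : all (fun x => x <= c) (rev t) by apply: H => a1 a2 a3 h1 h2; apply: leq_trans h1.
  by rewrite all_rev => /allP; apply.
(* A letter i + 1 that enters row i + 1 replaces the last letter c and is not
   stored, so that it empties the row from the right. *)
have Eb : below i.+1 i.+1 (rcons t c) = c.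
  apply: below_eq => [||z].
  - by case/andP: ci.
  - by rewrite !inE mem_rcons inE eqxx !orbT.
  by rewrite inE mem_rcons inE => /or3P[/eqP->|/eqP->//|/tc//]; rewrite ltnn.
have Ep : put i.+1 i.+1 (rcons t c) = t.
  apply: (wf_row_ext (wf_put _ _ _) wt) => d ds.
  have := count_put wb (ltn0Sn i) ds; rewrite Eb -cats1 count_cat /= addn0.
  by case/andP: (ds) => _ /ltn_eqF ->; rewrite eq_sym; clear; lia.
have wM : wf (rcons t c :: P) by rewrite /= E wb.
have iM : 0 < i < size (rcons t c :: P) by rewrite /= E i0 ltnSn.
have iN : i.+1 <= (size (rcons t c :: P)).+1 by rewrite /= E.
have := strict_rows_climb x wM iM iN; cbv zeta; rewrite /= climb_cons // E Eb Ep /= !subSS.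
have wQ := wf_climb c wP; have sQ : size (climb c P).1 = i by rewrite size_climb.
have IHt y := IH y _ wt wQ sQ.
rewrite climbs_rcons /mirror map_rcons rev_rcons /= => ->.
have kc : i.+1 - (climb c P).2 <= i.
  have := depth_eq0 c P; case/andP: ci => c0 _; rewrite [RHS]gtn_eqF //.
  by case: (climb c P).2 => // d _; rewrite subSS leq_subr.
case: eqVneq => [_|ne].
  rewrite IHt /mirror; split; first by case=> x0; case: x x0 => //.
  by case: x.
by rewrite ltn_eqF ?ltnS // IHt add0n.
Qed.

(** Emptying row r replaces the slack x by x - K_i + K_(i+1), where K_j
    counts the letters j in row r of the dual, and requires K_i <= x; this is
    the recursion that defines [lattice_at]. *)
Theorem lattice_at_dual i x M : wf M -> 0 < i -> i < size M ->
  lattice_at i x (dual M) <-> strict_rows i x M.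
Proof.
move=> wM i0; move En : (size M) => n.
elim: n M x En wM => [|n IH] [|b P] x // [E] wM iN.
have /andP[wb wP] := wM; rewrite /= in wb.
rewrite dual_cons /= size_dual size_climbs.
move: iN; rewrite ltnS -E leq_eqVlt => /orP[/eqP Ei|iP].
  rewrite strict_rows_last // -Ei ltnn.
  split; first by case=> [//|[]].
  by move=> H; right; split=> //; apply: lattice_at_small; rewrite size_dual size_climbs Ei.
have iP' : 0 < i < size P by rewrite i0.
rewrite strict_rows_cons // (strict_rows_climbs x wP) //; first last.
- exact: wf_row_letters wb.
- by case/andP: wb.
have wQ := wf_climbs b wP.
have sQ : size (climbs b P).1 = n by rewrite size_climbs.
rewrite E in iP; have H := fun y => IH _ y sQ wQ iP.
split.
  case=> [|[h1 /H h2]]; last by [].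
  by move=> h; move: iP h; rewrite -E; clear; lia.
by case=> h1 /H h2; right.
Qed.

(** * Rows with their zeros and diagonal entries *)

Definition fillrow (s z : nat) (a : seq nat) (l : nat) : seq nat :=
  nseq z 0 ++ a ++ nseq (l - z - size a) s.

Lemma size_fillrow s z a l : z + size a <= l -> size (fillrow s z a l) = l.
Proof. by rewrite /fillrow !size_cat !size_nseq; lia. Qed.

Lemma sorted_leq_pairwise (w : seq nat) : sorted leq w = pairwise leq w.
Proof. by apply: sorted_pairwise; exact: leq_trans. Qed.

Lemma fillrow_sorted s z a l : wf_row s a -> sorted leq (fillrow s z a l).
Proof.
move=> /andP[sa /allP ia].
have nn n x : sorted leq (nseq n x).
  by elim: n => //= n; case: n => //= n ->; rewrite leqnn.
rewrite sorted_leq_pairwise /fillrow !pairwise_cat -!sorted_leq_pairwise sa !nn /= !andbT.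
apply/andP; split.
  by apply/allrelP => x y; rewrite mem_nseq => /andP[_ /eqP->].
by apply/allrelP => x y /ia/andP[_ /ltnW xs]; rewrite mem_nseq => /andP[_ /eqP->].
Qed.

Lemma mem_fillrow s z a l x : x \in fillrow s z a l -> x \in [:: 0, s & a].
Proof.
rewrite !mem_cat !mem_nseq !inE => /or3P[/andP[_ ->]|->|/andP[_ ->]];
  by rewrite ?orbT.
Qed.

Lemma fillrow_le s z a l : wf_row s a -> all (fun x => x <= s) (fillrow s z a l).
Proof.
move=> wa; apply/allP => x /mem_fillrow; rewrite !inE.
by case/or3P=> [/eqP->//|/eqP->//|/(allP (wf_row_letters wa))].
Qed.

Lemma fillrow_interior s z a l : wf_row s a ->
  [seq x <- fillrow s z a l | interior s x] = a.
Proof.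
move=> /andP[_ /all_filterP ia]; rewrite /fillrow !filter_cat ia.
by rewrite !filter_nseq /interior /= ltnn andbF cats0.
Qed.

Lemma fillrow_count0 s z a l : wf_row s a -> 0 < s ->
  count_mem 0 (fillrow s z a l) = z.
Proof.
move=> /andP[_ /allP ia] s0; rewrite /fillrow !count_cat !count_nseq /= mul1n.
rewrite (gtn_eqF s0) mul0n addn0 -[RHS]addn0; congr (_ + _).
apply/eqP; rewrite -leqn0 leqNgt -has_count; apply/hasPn => x /ia.
by case: x.
Qed.

Lemma filter_pred1 x (w : seq nat) : filter (pred1 x) w = nseq (count_mem x w) x.
Proof. by rewrite -size_filter; apply/all_pred1P/filter_all. Qed.

Lemma fillrow_canon s w : 0 < s -> sorted leq w -> all (fun x => x <= s) w ->
  w = fillrow s (count_mem 0 w) [seq x <- w | interior s x] (size w).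
Proof.
move=> s0 sw ws.
apply: (sorted_eq leq_trans anti_leq sw).
  apply: fillrow_sorted; rewrite /wf_row filter_all sorted_filter //.
  exact: leq_trans.
have /permPl p1 := perm_filterC (pred1 0) w.
have /permPl p2 := perm_filterC (interior s) (filter (predC (pred1 0)) w).
have E1 : filter (interior s) (filter (predC (pred1 0)) w) = filter (interior s) w.
  rewrite -filter_predI; apply: eq_filter => x /=; rewrite /interior.
  by case: x => // x; rewrite andbT.
have E2 : filter (predC (interior s)) (filter (predC (pred1 0)) w) =
          nseq (count_mem s w) s.
  rewrite -filter_pred1 -filter_predI; apply: eq_in_filter => x /(allP ws) /= xs.
  by rewrite /interior; lia.
have sz : size w = count_mem 0 w + (size (filter (interior s) w) + count_mem s w).
  rewrite -[LHS](perm_size p1) size_cat -(perm_size p2) size_cat E1 E2 size_nseq.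
  by rewrite size_filter.
rewrite perm_sym; apply: perm_trans p1.
rewrite /fillrow filter_pred1 perm_cat2l -E1; apply: perm_trans p2.
by rewrite perm_cat2l E2 E1 sz addKn addKn.
Qed.

Lemma rightmost_ltP c R : has (fun x => x < c) R ->
  exists L p H, [/\ R = L ++ p :: H, p < c, all (leq c) H & rightmost_lt c R = size L].
Proof.
elim/last_ind: R => // R y IH; rewrite has_rcons.
have E : rightmost_lt c (rcons R y) =
   if y < c then size R else rightmost_lt c R.
  rewrite /rightmost_lt size_rcons -addn1 iotaD /= cats1 filter_rcons nth_rcons ltnn eqxx.
  case: ifP => _; first by rewrite last_rcons add0n.
  congr (last 0 _); apply: eq_in_filter => j; rewrite mem_iota /= add0n => jR.
  by rewrite nth_rcons jR.
rewrite E; case: ltnP => yc /=.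
  by exists R, y, [::]; rewrite cats1.
case/IH=> L [p [H [-> pc cH ->]]].
by exists L, p, (rcons H y); rewrite rcons_cat all_rcons yc.
Qed.

(** As long as the row has a true zero, replacing an entry in the tableau is
    the same as replacing it in the interior row: an entry c = s turns up as
    a diagonal entry because the length of the row is fixed. *)
Lemma fillrow_bump s z a l c : wf_row s a -> 0 < c <= s -> z + size a <= l ->
  (below s c a = 0 -> 0 < z) ->
  let R := fillrow s z a l in
  let j := rightmost_lt c R in
  let z' := z - (below s c a == 0) in
  [/\ nth 0 R j = below s c a,
      set_nth 0 R j c = fillrow s z' (put s c a) l,
      z' + size (put s c a) <= l
    & perm_eq (below s c a :: fillrow s z' (put s c a) l) (c :: R)].
Proof.
move=> wa /andP[c0 cs] zl zp R j z'.
have s0 : 0 < s by apply: leq_trans cs.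
have sR : sorted leq R by apply: fillrow_sorted.
have hR : has (fun x => x < c) R.
  apply/hasP; exists (below s c a); last exact: below_lt.
  case: (posnP (below s c a)) => [E|b0].
    by rewrite E /R /fillrow mem_cat mem_nseq zp.
  have := below_in s c a; have := below_lt s a c0; rewrite !inE => blt.
  case/or3P=> [/eqP E|/eqP E|ba]; [by rewrite E in b0| |].
    by move: blt; rewrite E ltnNge cs.
  by rewrite /R /fillrow !mem_cat ba orbT.
have [L [p [H [ER pc cH Ej]]]] := rightmost_ltP hR.
have Lp x : x \in L -> x <= p.
  move=> xL; move: sR; rewrite sorted_leq_pairwise ER pairwise_cat.
  by case/and3P=> /allrelP/(_ x p xL (mem_head p H)).
have pmax x : x \in R -> x < c -> x <= p.
  rewrite ER mem_cat inE => /or3P[/Lp//|/eqP->//|/(allP cH)] cx.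
  by rewrite ltnNge cx.
have Eb : below s c a = p.
  apply: below_eq => // [|t].
    by apply: (@mem_fillrow s z a l); rewrite -/R ER mem_cat mem_head orbT.
  rewrite inE => /orP[/eqP->|ta]; first by rewrite ltnNge cs.
  by apply: pmax; rewrite /R /fillrow !mem_cat ta orbT.
have Es : set_nth 0 R j c = L ++ c :: H.
  rewrite /j Ej ER; elim: (L) => //= y L' ->; by [].
set R' := L ++ c :: H in Es *.
have pR : perm_eq (p :: R') (c :: R).
  apply/permP => f; rewrite /R' ER /= !count_cat /=; lia.
have sR' : sorted leq R'.
  move: sR; rewrite !sorted_leq_pairwise ER /R' !pairwise_cat /=.
  case/and3P=> LH -> /andP[_ ->]; rewrite andbT; apply/andP; split=> //.
  move: LH; rewrite !allrel_consr => /andP[_ ->]; rewrite andbT.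
  by apply/allP => x /Lp xp; apply: leq_trans (ltnW pc).
have lR' : all (fun x => x <= s) R'.
  apply/allP => x xR'; have : x \in p :: R' by rewrite inE xR' orbT.
  rewrite (perm_mem pR) inE => /orP[/eqP->//|xR].
  exact: (allP (fillrow_le z l wa)).
have szR : size R' = l.
  by rewrite -(@size_fillrow s z a l zl) -/R ER /R' !size_cat.
have ER' : R' = fillrow s z' (put s c a) l.
  rewrite (fillrow_canon s0 sR' lR') szR; congr fillrow.
    have /permP/(_ (pred1 0)) := pR; rewrite /= fillrow_count0 // /z' Eb.
    by rewrite (gtn_eqF c0); clear; lia.
  apply: (wf_row_ext _ (wf_put _ _ _)).
    by rewrite /wf_row filter_all sorted_filter //; exact: leq_trans.
  move=> d ds; rewrite count_filter_interior //.
  have := count_put wa c0 ds; rewrite Eb.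
  have /permP/(_ (pred1 d)) := pR; rewrite /=.
  rewrite -(count_filter_interior R ds) /R fillrow_interior //.
  rewrite [c == d]eq_sym [p == d]eq_sym => H1 H2.
  apply/eqP; rewrite -(eqn_add2l (d == p)) H1 addnC eq_sym addnC H2.
  by rewrite addnC.
split=> //.
- by rewrite Eb /j Ej ER nth_cat ltnn subnn.
- by rewrite Es.
- rewrite -szR ER' /fillrow !size_cat !size_nseq; clear; lia.
by rewrite -ER' Eb.
Qed.

(** * Tableaux with prescribed interior entries *)

Fixpoint fill (z lam : nat -> nat) (M : seq (seq nat)) : tableau :=
  if M is a :: P then
    rcons (fill z lam P) (fillrow (size M) (z (size M)) a (lam (size M)))
  else [::].

Fixpoint fits (z lam : nat -> nat) (M : seq (seq nat)) : bool :=
  if M is a :: P then (z (size M) + size a <= lam (size M)) && fits z lam P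
  else true.

Lemma size_fill z lam M : size (fill z lam M) = size M.
Proof. by elim: M => //= a P IH; rewrite size_rcons IH. Qed.

Lemma fill_ext z z' lam M : (forall s, 0 < s <= size M -> z s = z' s) ->
  fill z lam M = fill z' lam M.
Proof.
elim: M => //= a P IH H; rewrite H ?ltnS ?leqnn // IH // => s /andP[s0 sP].
by apply: H; rewrite s0 ltnW.
Qed.

Lemma fits_ext z z' lam M : (forall s, 0 < s <= size M -> z s = z' s) ->
  fits z lam M = fits z' lam M.
Proof.
elim: M => //= a P IH H; rewrite H ?ltnS ?leqnn // IH // => s /andP[s0 sP].
by apply: H; rewrite s0 ltnW.
Qed.

Lemma count_flatten_rcons (x : nat) T r :
  count_mem x (flatten (rcons T r)) = count_mem x (flatten T) + count_mem x r.
Proof. by rewrite flatten_rcons count_cat. Qed.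

(** The only zero that is replaced is in the terminating row k, so that one
    true zero in this row is enough. The last clause says that the contents
    of the tableau change by the exchange of this zero and c. *)
Lemma fill_climb P c z lam X : wf P -> fits z lam P -> 0 < c <= size P ->
  let k := (size P).+1 - (climb c P).2 in
  let z' j := z j - (j == k) in
  let Q := (climb c P).1 in
  0 < z k ->
  [/\ bump_up (size P) c (fill z lam P ++ X) = (fill z' lam Q ++ X, k),
      fits z' lam Q
    & forall x, count_mem x (flatten (fill z' lam Q)) + (x == 0) =
                count_mem x (flatten (fill z lam P)) + (x == c)].
Proof.
elim: P c X => [|a P IH] c X; first by move=> _ _ /andP[c0]; rewrite leqNgt c0.
move=> wM fM cP; have /andP[c0 cN] := cP; cbv zeta.
have /andP[wa wP] : wf_row (size P).+1 a && wf P := wM.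
have /andP[fa fP] : (z (size P).+1 + size a <= lam (size P).+1) && fits z lam P := fM.
have s0 : 0 < (size P).+1 by [].
have blt := below_lt (size P).+1 a c0.
set c' := below (size P).+1 c a; set a' := put (size P).+1 c a.
have -> : (climb c (a :: P)).1 = a' :: (climb c' P).1 by rewrite climb_cons.
have -> : (climb c (a :: P)).2 = (climb c' P).2.+1 by rewrite climb_cons.
rewrite subSS => z0.
have zp : c' = 0 -> 0 < z (size P).+1.
  by move=> E; move: z0; rewrite E climb0 subn0.
have [Ej Es fa' pa] := fillrow_bump wa cP fa zp.
rewrite -/c' -/a' in Ej Es fa' pa.
have nthX T (r : seq nat) Y n : size T = n -> nth [::] (rcons T r ++ Y) n = r.
  by move=> <-; rewrite nth_cat size_rcons ltnSn nth_rcons ltnn eqxx.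
have setX T (r r' : seq nat) Y n : size T = n ->
    set_nth [::] (rcons T r ++ Y) n r' = rcons T r' ++ Y.
  by move=> <-; elim: T => //= u T ->.
have pc x (r : seq nat) n :
    let R := fillrow (size P).+1 n a (lam (size P).+1) in
    perm_eq (c' :: r) (c :: R) ->
    count_mem x r + (x == c') = count_mem x R + (x == c).
  move=> R /permP/(_ (pred1 x)) /=; rewrite [c' == x]eq_sym [c == x]eq_sym.
  by rewrite addnC => ->; rewrite addnC.
have bumpE : bump_up (size (a :: P)) c (fill z lam (a :: P) ++ X) =
   (let T' := rcons (fill z lam P)
       (fillrow (size P).+1 (z (size P).+1 - (c' == 0)) a' (lam (size P).+1)) ++ X in
    if c' == 0 then (T', (size P).+1) else bump_up (size P) c' T').
  by rewrite /= nthX ?size_fill // Ej setX ?size_fill // Es.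
rewrite bumpE; cbv zeta.
case: (posnP c') => [E|c'0].
  rewrite E climb0 subn0 [(_, _).1]/=.
  have zE s : 0 < s <= size P -> z s - (s == (size P).+1) = z s.
    by move=> /andP[_ sP]; rewrite ltn_eqF // subn0.
  split=> /=.
  - rewrite eqxx; congr (rcons _ _ ++ _, _); symmetry; exact: fill_ext.
  - by rewrite eqxx (fits_ext lam zE) fP andbT; move: fa'; rewrite E eqxx.
  move=> x; rewrite eqxx (fill_ext lam zE) !count_flatten_rcons.
  have := pc x _ _ pa; rewrite E eqxx => pcx.
  by rewrite -addnA pcx addnA.
have c'P : 0 < c' <= size P by rewrite c'0 -ltnS; apply: leq_trans blt cN.
pose R' := fillrow (size P).+1 (z (size P).+1) a' (lam (size P).+1).
have [IH1 IH2 IH3] := IH c' (R' :: X) wP fP c'P z0.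
have kP : (size P).+1 == (size P).+1 - (climb c' P).2 = false.
  by rewrite gtn_eqF // ltn_subrL lt0n depth_eq0 -lt0n c'0.
rewrite ?(gtn_eqF c'0) ?subn0.
split=> /=.
- rewrite !cat_rcons IH1 size_climb kP subn0; by [].
- by rewrite size_climb kP subn0 IH2 andbT; move: fa'; rewrite (gtn_eqF c'0) subn0.
move=> x; rewrite size_climb kP subn0 !count_flatten_rcons.
have := pc x _ _ pa; rewrite (gtn_eqF c'0) subn0 => pcx.
by rewrite addnAC IH3 -[RHS]addnA -pcx addnA addnAC.
Qed.

(** * Deletions on tableaux *)

Definition row_if_nonempty (w : seq nat) : tableau := [seq r <- [:: w] | r != [::]].

Lemma filter_fill z lam P : fits z lam P ->
  (forall s, 0 < s <= size P -> 0 < lam s) ->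
  [seq r <- fill z lam P | r != [::]] = fill z lam P.
Proof.
elim: P => //= a P IH /andP[fa fP] lp.
rewrite filter_rcons -size_eq0 size_fillrow // -lt0n lp ?ltnS ?leqnn // IH //.
by move=> s /andP[s0 sP]; apply: lp; rewrite s0 ltnW.
Qed.

(** The three cases of a deletion are one: an entry equal to its row number
    or to zero is a virtual letter, which climbs without moving anything. *)
Lemma corner_deletion_fill P z lam t c : wf P -> fits z lam P ->
  (forall s, 0 < s <= size P -> 0 < lam s) -> c <= (size P).+1 ->
  let k := (size P).+1 - (climb c P).2 in
  let z' j := z j - (j == k) in
  let Q := (climb c P).1 in
  (0 < k < (size P).+1 -> 0 < z k) ->
  [/\ corner_deletion (size P).+1 (rcons (fill z lam P) (rcons t c)) =
        (fill z' lam Q ++ row_if_nonempty t, k),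
      fits z' lam Q
    & forall x, 0 < x < (size P).+1 ->
        count_mem x (flatten (fill z' lam Q)) =
        count_mem x (flatten (fill z lam P)) + (x == c)].
Proof.
move=> wP fP lp cN; cbv zeta => zk.
have nthE : nth [::] (rcons (fill z lam P) (rcons t c)) (size P) = rcons t c.
  by rewrite nth_rcons size_fill ltnn eqxx.
have remE : remove_last (size P).+1 (rcons (fill z lam P) (rcons t c)) =
    fill z lam P ++ row_if_nonempty t.
  rewrite /remove_last /= nthE size_rcons /= -!cats1 take_size_cat //.
  have -> : set_nth [::] (fill z lam P ++ [:: t ++ [:: c]]) (size P) t =
      fill z lam P ++ [:: t].
    rewrite -(size_fill z lam P); by elim: (fill z lam P) => //= u T ->.
  by rewrite filter_cat filter_fill.
have zE k : (0 < k < (size P).+1 = false) ->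
    forall s, 0 < s <= size P -> z s - (s == k) = z s.
  move=> kN s /andP[s0 sP]; case: eqP => [E|]; rewrite ?subn0 //.
  by move: kN; rewrite -E s0 ltnS sP.
have trivial k : (0 < k < (size P).+1 = false) -> (c = 0 \/ c = (size P).+1) ->
  [/\ (fill z lam P ++ row_if_nonempty t, k) =
        (fill (fun j => z j - (j == k)) lam P ++ row_if_nonempty t, k),
      fits (fun j => z j - (j == k)) lam P
    & forall x, 0 < x < (size P).+1 ->
        count_mem x (flatten (fill (fun j => z j - (j == k)) lam P)) =
        count_mem x (flatten (fill z lam P)) + (x == c)].
  move=> kN cE; split.
  - by rewrite (fill_ext _ (zE k kN)).
  - by rewrite (fits_ext _ (zE k kN)).
  move=> x /andP[x0 xN]; rewrite (fill_ext _ (zE k kN)).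
  by case: cE => ->; rewrite ?(gtn_eqF x0) ?(ltn_eqF xN) addn0.
rewrite /corner_deletion remE nthE last_rcons.
case: eqVneq => [cE|cne].
  have -> : climb c P = (P, (size P).+1) by rewrite cE climb_top.
  by rewrite subnn; apply: trivial; [|right].
case: eqVneq => [cE|c0].
  have -> : climb c P = (P, 0) by rewrite cE climb0.
  by rewrite subn0; apply: trivial; [rewrite ltnn | left].
have cP : 0 < c <= size P.
  by rewrite lt0n c0 -ltnS ltn_neqAle cne cN.
have d0 : 0 < (climb c P).2 by rewrite lt0n depth_eq0.
have dP : (climb c P).2 <= size P by apply: depth_le; case/andP: cP.
have z0 : 0 < z ((size P).+1 - (climb c P).2).
  by apply: zk; rewrite subn_gt0 ltnS dP ltn_subrL d0.
have [E1 E2 E3] := fill_climb (row_if_nonempty t) wP fP cP z0.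
split=> // x /andP[x0 xN]; have := E3 x; rewrite (gtn_eqF x0) addn0; exact.
Qed.

Lemma corner_deletions_fill P z lam w : wf P -> fits z lam P ->
  (forall s, 0 < s <= size P -> 0 < lam s) ->
  all (fun c => c <= (size P).+1) w ->
  let ks := mirror (size P).+1 (climbs w P).2 in
  (forall s, 0 < s < (size P).+1 -> count_mem s ks <= z s) ->
  let z' s := z s - count_mem s ks in
  [/\ corner_deletions (size P).+1 (size w) (fill z lam P ++ row_if_nonempty w) =
        (fill z' lam (climbs w P).1, ks),
      fits z' lam (climbs w P).1
    & forall x, 0 < x < (size P).+1 ->
        count_mem x (flatten (fill z' lam (climbs w P).1)) =
        count_mem x (flatten (fill z lam P)) + count_mem x w].
Proof.
elim/last_ind: w P z => [|t c IH] P z wP fP lp wN; cbv zeta.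
  move=> _ /=; rewrite cats0.
  have zE s : 0 < s <= size P -> z s - 0 = z s by rewrite subn0.
  split; first by rewrite (fill_ext _ zE).
    by rewrite (fits_ext _ zE).
  by move=> x _; rewrite (fill_ext _ zE) addn0.
move: wN; rewrite all_rcons => /andP[cN tN].
rewrite climbs_rcons [(_, _).1]/= [(_, _).2]/= /mirror map_rcons rev_rcons.
set k := (size P).+1 - _; set P1 := (climb c P).1 => kz.
have sP1 : size P1 = size P by rewrite size_climb.
have kz1 : 0 < k < (size P).+1 -> 0 < z k.
  by move/kz; rewrite /= eqxx; apply: leq_trans.
have [E1 F1 C1] := corner_deletion_fill t wP fP lp cN kz1.
rewrite -/k -/P1 in E1 F1 C1.
have w1 : wf P1 by apply: wf_climb.
have lp1 s : 0 < s <= size P1 -> 0 < lam s by rewrite sP1; apply: lp.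
have tN1 : all (fun c => c <= (size P1).+1) t by rewrite sP1.
have := IH P1 _ w1 F1 lp1 tN1; cbv zeta; rewrite sP1 => H.
have [|E2 F2 C2] := H.
  move=> s sN; have := kz s sN; rewrite /= eq_sym => ks.
  by rewrite -(leq_add2l (s == k)) subnKC //; apply: leq_trans ks; apply: leq_addr.
have zE s : 0 < s <= size (climbs t P1).1 ->
  z s - (s == k) - count_mem s (mirror (size P).+1 (climbs t P1).2) =
  z s - count_mem s (k :: rev [seq (size P).+1 - d | d <- (climbs t P1).2]).
  by move=> _; rewrite -subnDA /= eq_sym.
rewrite -(fill_ext _ zE) -(fits_ext _ zE); split=> //.
  rewrite size_rcons /= /row_if_nonempty /= -size_eq0 size_rcons cats1 E1 E2.
  by [].
move=> x xN; rewrite C2 // C1 // -cats1 count_cat /= addn0 [c == x]eq_sym.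
by rewrite addnAC addnA.
Qed.

(** * Partners as duals *)

Lemma residual_shift n T k :
  residual n.+1 T k.+1 = residual n (full_deletion n.+1 T).1 k.
Proof. by elim: k => [|k IH] //; rewrite /= -IH subSS. Qed.

Lemma partner_short n T : size T <= n -> partner n.+1 T = partner n T.
Proof.
move=> Tn; apply/eq_in_map => r; rewrite mem_iota => /andP[r0 rT].
have rn : r <= n by move: rT; rewrite add1n ltnS => /leq_trans; apply.
rewrite subSn // residual_shift.
by have -> : full_deletion n.+1 T = (T, [::]) by rewrite /full_deletion ltn_eqF.
Qed.

Lemma partner_rcons n T : size T = n.+1 -> size (full_deletion n.+1 T).1 = n ->
  partner n.+1 T =
    rcons (partner n (full_deletion n.+1 T).1) (full_deletion n.+1 T).2.
Proof.
move=> Tn T'n; rewrite /partner Tn T'n.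
have -> : iota 1 n.+1 = rcons (iota 1 n) n.+1 by rewrite -(addn1 n) iotaD cats1 addnC.
rewrite map_rcons subnn.
congr rcons; apply/eq_in_map => r; rewrite mem_iota add1n ltnS => /andP[r0 rn].
by rewrite subSn // residual_shift.
Qed.

Lemma partner_size n T : size T <= n -> partner n T = partner (size T) T.
Proof.
elim: n => [|n IH]; first by rewrite leqn0 => /eqP->.
by rewrite leq_eqVlt => /orP[/eqP->//|Tn]; rewrite partner_short // IH.
Qed.

(** The entries of a row are at most its row number. *)
Lemma count_fill_high z lam M s : wf M -> size M < s ->
  count_mem s (flatten (fill z lam M)) = 0.
Proof.
elim: M => // a P IH wM sM.
have /andP[wa wP] : wf_row (size P).+1 a && wf P := wM.
rewrite /= count_flatten_rcons IH ?(ltnW sM) //.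
apply/eqP; rewrite add0n -leqn0 leqNgt -has_count; apply/hasPn => x.
move/(allP (fillrow_le _ _ wa)) => xN /=; rewrite ltn_eqF //.
exact: leq_ltn_trans sM.
Qed.

(** The two kinds of virtual letters correspond to the two extreme depths, so
    that the diagonal entries of a row become zeros of the partner, and the
    zeros become diagonal entries. *)
Lemma climbs_count_extreme w P x : wf P -> all (fun c => c <= (size P).+1) w ->
  x = 0 \/ x = (size P).+1 -> count_mem x (climbs w P).2 = count_mem x w.
Proof.
move=> wP; elim: w => //= c t IH /andP[cN tN] xE; rewrite IH //.
have wt := wf_climbs t wP; congr (nat_of_bool _ + _).
case: xE => ->; first by rewrite depth_eq0.
move: cN; rewrite leq_eqVlt => /orP[/eqP->|cN].
  by have := climb_top wt; rewrite size_climbs => ->; rewrite eqxx.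
have := @depth_le c (climbs t P).1; rewrite size_climbs => /(_ cN) dP.
by rewrite (ltn_eqF cN) ltn_eqF.
Qed.

Lemma count_mirror N D x : all (fun d => d <= N) D -> x <= N ->
  count_mem x (mirror N D) = count_mem (N - x) D.
Proof.
move=> DN xN; rewrite /mirror count_rev count_map.
apply: eq_in_count => d /(allP DN) /= dN; clear DN; lia.
Qed.

Lemma full_deletion_fill z lam a P : wf (a :: P) -> fits z lam (a :: P) ->
  (forall s, 0 < s <= size (a :: P) -> 0 < lam s) ->
  let N := size (a :: P) in
  let R := fillrow N (z N) a (lam N) in
  full_deletion N (fill z lam (a :: P)) =
    corner_deletions N (size R) (fill z lam P ++ row_if_nonempty R).
Proof.
move=> wM fM lp; cbv zeta.
have /andP[fa fP] : (z (size P).+1 + size a <= lam (size P).+1) && fits z lam P := fM.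
rewrite /full_deletion size_fill eqxx size_fillrow //.
rewrite /part /outer /= map_rcons nth_rcons size_map size_fill ltnn eqxx size_fillrow //.
rewrite /row_if_nonempty /= -size_eq0 size_fillrow // -lt0n lp ?cats1 //=.
Qed.

(** The hypothesis on the dual says that row s has at least as many zeros as
    there are chains terminating in it while lower rows are emptied.
    Conversely the zeros left in row s when it is emptied are recorded as
    entries s, so that the partner has weight z. *)
Theorem partner_fill M z lam nu : wf M -> fits z lam M ->
  (forall s, 0 < s <= size M -> 0 < lam s) ->
  (forall s, 0 < s < size M -> count_mem s (flatten (dual M)) <= z s) ->
  (forall s, 0 < s <= size M -> count_mem s (flatten (fill z lam M)) = nu s) ->
  [/\ partner (size M) (fill z lam M) = fill nu lam (dual M),
      fits nu lam (dual M)
    & forall s, 0 < s <= size M ->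
        count_mem s (flatten (fill nu lam (dual M))) = z s].
Proof.
move En : (size M) => n.
elim: n M z En => [|n IH] [|a P] z //.
  by split=> // s /andP[s0]; rewrite leqNgt s0.
move=> [E] wM fM lp zM nuM.
have /andP[wa wP] : wf_row (size P).+1 a && wf P := wM.
have /andP[fa fP] : (z (size P).+1 + size a <= lam (size P).+1) && fits z lam P := fM.
have lp' : forall s, 0 < s <= size (a :: P) -> 0 < lam s by rewrite /= E.
have lpP s : 0 < s <= size P -> 0 < lam s.
  by rewrite E => /andP[s0 sP]; apply: lp; rewrite s0 ltnW.
have := full_deletion_fill wM fM lp'; cbv zeta; rewrite [size (a :: P)]/=.
set R := fillrow _ _ a _ => fdE.
have RN : all (fun c => c <= (size P).+1) R by apply: fillrow_le.
have sR : sorted leq R by apply: fillrow_sorted.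
have szR : size R = lam (size P).+1 by apply: size_fillrow.
have := climbs_interior wP RN; rewrite fillrow_interior // => actE.
pose ks := mirror (size P).+1 (climbs R P).2.
have DN := climbs_depth_le wP RN.
have KE : mirror (size P).+1 (climbs a P).2 = [seq k <- ks | interior (size P).+1 k].
  by rewrite actE /= mirror_interior.
have cks s : 0 < s < (size P).+1 ->
   count_mem s (mirror (size P).+1 (climbs a P).2) = count_mem s ks.
  by move=> sN; rewrite KE count_filter_interior.
have dualE : dual (a :: P) = mirror (size P).+1 (climbs a P).2 :: dual (climbs R P).1.
  by rewrite dual_cons actE.
have kz s : 0 < s < (size P).+1 ->
    count_mem s ks + count_mem s (flatten (dual (climbs R P).1)) <= z s.
  move=> sN; rewrite -cks // -count_cat; have := zM s; rewrite dualE -E => /(_ sN).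
  by [].
have [] := corner_deletions_fill wP fP lpP RN.
  by move=> s sN; apply: leq_trans (kz s sN); apply: leq_addr.
rewrite -/ks; set z' := fun s => _; rewrite -fdE => fdE' fits' cnt'.
have sP' : size (climbs R P).1 = n by rewrite size_climbs.
have [] := IH _ z' sP' (wf_climbs R wP) fits'.
- by move=> s sn; apply: lpP; rewrite E.
- move=> s /andP[s0 sn]; have := kz s; rewrite s0 ltnS E (ltnW sn) => /(_ isT).
  move=> H; rewrite /z' -(leq_add2l (count_mem s ks)) subnKC //.
  by apply: leq_trans H; apply: leq_addr.
- move=> s /andP[s0 sn].
  have sN : 0 < s < (size P).+1 by rewrite s0 ltnS E.
  have sn' : 0 < s <= n.+1 by rewrite s0 ltnW.
  by rewrite (cnt' s sN) -(nuM s sn') [fill z lam (a :: P)]/= count_flatten_rcons.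
move=> pE fE cE.
have ksN : all (fun k => k <= (size P).+1) ks.
  by apply/allP => k /mem_mirror[d _ ->]; apply: leq_subr.
have szks : size ks = lam (size P).+1.
  by rewrite /ks /mirror size_rev size_map size_climbs_depths.
have ks0 : count_mem 0 ks = nu (size P).+1.
  rewrite count_mirror // subn0 climbs_count_extreme //; last by right.
  rewrite -nuM; last by rewrite -E leqnn.
  by rewrite [fill z lam (a :: P)]/= count_flatten_rcons count_fill_high.
have ksNN : count_mem (size P).+1 ks = z (size P).+1.
  rewrite count_mirror // subnn climbs_count_extreme //; last by left.
  by rewrite fillrow_count0.
have ksE : ks = fillrow (size P).+1 (nu (size P).+1)
    (mirror (size P).+1 (climbs a P).2) (lam (size P).+1).
  rewrite KE -ks0 -szks; apply: fillrow_canon => //.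
  exact/mirror_sorted/climbs_sorted.
have fillE : fill nu lam (dual (a :: P)) = rcons (fill nu lam (dual (climbs R P).1)) ks.
  by rewrite dualE /= size_dual size_climbs -ksE.
split.
- rewrite fillE -pE -E.
  have := partner_rcons (n := size P) (T := fill z lam (a :: P)).
  by rewrite size_fill fdE' /= size_fill size_climbs => -> //; rewrite E.
- rewrite dualE /= fE andbT size_dual size_climbs -szks ksE /fillrow !size_cat !size_nseq.
  by rewrite addnA leq_addr.
move=> s /andP[s0]; rewrite fillE count_flatten_rcons leq_eqVlt => /orP[/eqP->|sn].
  rewrite count_fill_high ?wf_dual ?wf_climbs // ?size_dual ?sP' //.
  by rewrite add0n -E ksNN.
have sN : 0 < s < (size P).+1 by rewrite s0 E.
rewrite cE ?s0 // /z' subnK //; apply: leq_trans (kz s sN); exact: leq_addr.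
Qed.

(** * The lattice condition on tableaux *)

Lemma wf_row_at M s : wf M -> 0 < s <= size M -> wf_row s (row_at M s).
Proof.
elim: M => [|a P IH]; first by move=> _ /andP[]; case: s.
move=> wM /andP[s0]; have /andP[wa wP] : wf_row (size P).+1 a && wf P := wM.
rewrite leq_eqVlt => /orP[/eqP->|sP]; first by rewrite row_at_head.
by rewrite row_at_cons ?IH // s0.
Qed.

Lemma fits_row_at z lam M s : fits z lam M -> 0 < s <= size M ->
  z s + size (row_at M s) <= lam s.
Proof.
elim: M => [|a P IH]; first by move=> _ /andP[]; case: s.
move=> fM /andP[s0].
have /andP[fa fP] : (z (size P).+1 + size a <= lam (size P).+1) && fits z lam P := fM.
rewrite leq_eqVlt => /orP[/eqP->|sP]; first by rewrite row_at_head.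
by rewrite row_at_cons ?IH // s0.
Qed.

Lemma nth_fill z lam M s : 0 < s <= size M ->
  nth [::] (fill z lam M) s.-1 = fillrow s (z s) (row_at M s) (lam s).
Proof.
elim: M => [|a P IH] /andP[s0]; first by rewrite leqNgt s0.
rewrite leq_eqVlt => /orP[/eqP->|sP].
  by rewrite row_at_head /= nth_rcons size_fill ltnn eqxx.
rewrite row_at_cons ?s0 // -IH ?s0 //= nth_rcons size_fill.
by rewrite (prednK s0) (sP : s <= size P).
Qed.

Lemma part_anti lam i : is_part lam -> 0 < i -> part lam i.+1 <= part lam i.
Proof.
move=> /andP[sl _]; case: i => // i _; rewrite /part /=.
case: (ltnP i.+1 (size lam)) => il; last by rewrite nth_default.
by move/(sortedP 0): sl => /(_ i il).
Qed.

Lemma part_antiW lam i j : is_part lam -> 0 < i <= j -> part lam j <= part lam i.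
Proof.
move=> pl /andP[i0]; elim: j => [|j IH]; first by rewrite leqn0; case: i i0.
rewrite leq_eqVlt => /orP[/eqP->//|ij].
by apply: leq_trans (IH ij); apply: part_anti => //; exact: leq_trans i0 ij.
Qed.

Lemma part_pos lam i : is_part lam -> 0 < i -> (0 < part lam i) = (i <= size lam).
Proof.
move=> /andP[_ l0]; case: i => // i _; rewrite /part /=.
case: (ltnP i (size lam)) => il; last by rewrite nth_default.
by rewrite lt0n; apply: contraNneq l0 => <-; apply: mem_nth.
Qed.

(** The diagonal entries i + 1 and i are in the highest rows where these
    letters can occur, and enter the condition only through the totals. *)
Lemma lattice_fill i z lam D x : wf D -> 0 < i ->
  let F := fill z lam D in
  count_mem i (flatten F) = count_mem i.+1 (flatten F) + x ->
  (forall r, 0 < r <= size D ->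
     count_mem i.+1 (flatten (take r F)) <= count_mem i (flatten (take r.-1 F)))
  <-> lattice_at i x D.
Proof.
elim: D x => [|K D IH] x wD i0; cbv zeta.
  by move=> _; split=> // _ r /andP[]; case: r.
have /andP[wK wD'] : wf_row (size D).+1 K && wf D := wD.
have cK j : 0 < j <= size D ->
  count_mem j (fillrow (size D).+1 (z (size D).+1) K (lam (size D).+1)) = count_mem j K.
  by move=> jD; rewrite -(count_filter_interior (s := (size D).+1)) ?fillrow_interior.
rewrite [fill _ _ _]/=; set F := fill z lam D; set R := fillrow _ _ _ _.
have sF : size F = size D by rewrite size_fill.
have takeF r : r <= size D -> take r (rcons F R) = take r F.
  by move=> rD; rewrite -cats1 takel_cat // sF.
have takeN : take (size D).+1 (rcons F R) = rcons F R.
  by rewrite take_oversize // size_rcons sF.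
have high r : size D <= i -> count_mem i.+1 (flatten (take r F)) = 0.
  move=> Di; apply/eqP; rewrite -leqn0.
  rewrite -(@count_fill_high z lam D i.+1) // -/F -{2}(cat_take_drop r F).
  by rewrite flatten_cat count_cat leq_addr.
rewrite !count_flatten_rcons => Hx.
case: (ltnP (size D) i) => [Di|iD].
  split=> _; first by left.
  move=> r; rewrite -[size _]/(size D).+1 => /andP[r0].
  rewrite leq_eqVlt => /orP[/eqP->|rD]; last by rewrite takeF // high // ltnW.
  rewrite takeN.
  have -> // : count_mem i.+1 (flatten (rcons F R)) = 0.
  exact: (@count_fill_high z lam (K :: D)).
have iD' : 0 < i <= size D by rewrite i0.
rewrite cK // in Hx.
have lastE : (count_mem i.+1 (flatten (take (size D).+1 (rcons F R))) <=
   count_mem i (flatten (take (size D) (rcons F R)))) = (count_mem i K <= x).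
  rewrite takeN takeF // -sF take_size count_flatten_rcons -(leq_add2r (count_mem i K)) Hx.
  by rewrite leq_add2l.
have rest : count_mem i K <= x ->
  (forall r, 0 < r <= size D ->
     count_mem i.+1 (flatten (take r F)) <= count_mem i (flatten (take r.-1 F)))
  <-> lattice_at i (x - count_mem i K + count_mem i.+1 K) D.
  move=> Kx; move: iD; rewrite leq_eqVlt => /orP[/eqP iE|iD].
    split=> _; first by apply: lattice_at_small; rewrite -iE.
    by move=> r _; rewrite high // -iE.
  apply: IH => //.
  rewrite cK in Hx; last by rewrite iD.
  apply/eqP; rewrite -(eqn_add2r (count_mem i K)) Hx -/F; apply/eqP.
  move: Kx; clear.
  move: (count_mem i K) (count_mem i.+1 K) (count_mem i.+1 (flatten F)); lia.
split=> [H|].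
  have Kx : count_mem i K <= x by rewrite -lastE; apply: H => /=.
  right; split=> //; apply/rest => // r /andP[r0 rD].
  have rD' : r.-1 <= size D by apply: leq_trans rD; apply: leq_pred.
  have rN : 0 < r <= size (K :: D) by rewrite r0 ltnW.
  by have := H r rN; rewrite !takeF.
case=> [Di|[Kx /(rest Kx) H]]; first by move: iD; rewrite leqNgt Di.
move=> r; rewrite -[size (_ :: _)]/(size D).+1 => /andP[r0].
rewrite leq_eqVlt => /orP[/eqP->|rD]; first by rewrite lastE.
have rD' : r.-1 <= size D by apply: leq_trans (leq_pred r) _.
by rewrite !takeF //; apply: H; rewrite r0.
Qed.

(** * Littlewood-Richardson tableaux *)

Lemma sorted_nth_le w j k : sorted leq w -> j < size w ->
  (nth 0 w j <= k) = (j < count (fun e => e <= k) w).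
Proof.
elim: w j => // x w IH j sw jw.
have sw' := path_sorted sw; have xw := order_path_min leq_trans sw.
rewrite /=; case: (leqP x k) => xk.
  by case: j jw => [|j] jw; rewrite /= ?xk // add1n ltnS IH.
have -> : count (fun e => e <= k) w = 0.
  apply/eqP; rewrite -leqn0 leqNgt -has_count; apply/hasPn => y /(allP xw) xy.
  by rewrite -ltnNge; apply: leq_trans xy.
rewrite addn0 ltn0; apply/negbTE; rewrite -ltnNge.
case: j jw => // j jw /=; apply: leq_trans xk _.
by move/allP: xw; apply; apply: mem_nth.
Qed.

Lemma nth_fillrow_eq0 s z a l j : 0 < s -> wf_row s a -> z + size a <= l -> j < l ->
  (nth 0 (fillrow s z a l) j == 0) = (j < z).
Proof.
move=> s0 /andP[_ /allP ia] zl jl; rewrite nth_cat size_nseq.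
case: ltnP => jz; first by rewrite nth_nseq jz.
apply/negbTE; rewrite -lt0n.
have : nth 0 (a ++ nseq (l - z - size a) s) (j - z) \in a ++ nseq (l - z - size a) s.
  apply: mem_nth; rewrite size_cat size_nseq subnKC.
    by apply: ltn_sub2r => //; apply: leq_ltn_trans jl.
  by rewrite leq_subRL // (leq_trans _ zl) // leq_addr.
by rewrite mem_cat mem_nseq => /orP[/ia/andP[]//|/andP[_ /eqP->]].
Qed.

Lemma count_le_fillrow s z a l k : k < s ->
  count (fun e => e <= k) (fillrow s z a l) = z + count (fun e => e <= k) a.
Proof.
move=> ks; rewrite /fillrow !count_cat !count_nseq /= mul1n.
by rewrite leqNgt ks mul0n addn0.
Qed.

(** The j-th entry of a sorted row is at most k if and only if more than j
    entries are at most k; so counting entries in the two rows is the same as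
    comparing them column by column. Zeros account for the term zA - zB, and
    diagonal entries are larger than anything above them. *)
Lemma colstrict_fillrow i zA zB a b lA lB :
  0 < i -> wf_row i a -> wf_row i.+1 b -> zA + size a <= lA -> zB + size b <= lB ->
  lB <= lA -> zB <= zA ->
  let A := fillrow i zA a lA in
  let B := fillrow i.+1 zB b lB in
  colstrict i (zA - zB) a b <->
  (forall j, 0 < nth 0 B j -> nth 0 A j < nth 0 B j).
Proof.
move=> i0 wa wb fa fb lBA zBA A B.
have sA : sorted leq A by apply: fillrow_sorted.
have sB : sorted leq B by apply: fillrow_sorted.
have szA : size A = lA by apply: size_fillrow.
have szB : size B = lB by apply: size_fillrow.
split=> [H j Bj|H k ki].
  case: (ltnP j lB) => jB; last by rewrite nth_default ?szB in Bj.
  have jA : j < lA by apply: leq_trans lBA.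
  set k := nth 0 B j in Bj *.
  have kB : k <= i.+1.
    by apply: (allP (fillrow_le zB lB wb)); apply: mem_nth; rewrite szB.
  move: kB; rewrite leq_eqVlt => /orP[/eqP->|ki].
    by rewrite ltnS; apply: (allP (fillrow_le zA lA wa)); apply: mem_nth; rewrite szA.
  rewrite -[k]prednK // ltnS sorted_nth_le ?szA // count_le_fillrow; last first.
    by rewrite prednK.
  have : nth 0 B j <= k by [].
  rewrite sorted_nth_le ?szB // count_le_fillrow // => jk.
  apply: leq_trans jk _; have := H k ki.
  rewrite -(leq_add2l zB) => /leq_trans; apply.
  rewrite addnCA subnKC // addnC leq_add2l; apply: sub_count => e /=.
  by rewrite -[in X in X -> _](prednK Bj) ltnS.
case: (posnP k) => [->|k0].
  rewrite (@eq_in_count _ _ pred0) ?count_pred0 // => e eb /=.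
  by case/andP: wb => _ /allP /(_ e eb) /andP[e0 _]; rewrite leqn0 gtn_eqF.
rewrite -(leq_add2l zB) addnCA subnKC // [_ + zA]addnC.
rewrite -(count_le_fillrow zB b lB (ki : k < i.+1)) -/B.
have -> : count (fun e => e < k) a = count (fun e => e <= k.-1) a.
  by apply: eq_count => e /=; rewrite -[in LHS](prednK k0).
rewrite -(@count_le_fillrow i zA a lA); last by rewrite prednK.
rewrite -/A; set m := count _ _.
have mB : m <= lB by rewrite -szB; apply: count_size.
case: (leqP m zB) => mz.
  rewrite count_le_fillrow; last by rewrite prednK.
  by apply: leq_trans mz _; apply: leq_trans zBA _; apply: leq_addr.
have m0 : 0 < m by apply: leq_ltn_trans mz.
have mlt : m.-1 < lB by rewrite prednK.
have Bm : 0 < nth 0 B m.-1.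
  by rewrite lt0n nth_fillrow_eq0 // -leqNgt -ltnS prednK.
have Bk : nth 0 B m.-1 <= k by rewrite sorted_nth_le ?szB // -/m prednK.
have : nth 0 A m.-1 <= k.-1.
  by rewrite -ltnS prednK //; apply: leq_trans (H _ Bm) Bk.
rewrite sorted_nth_le ?szA; first by rewrite prednK.
  by [].
exact: leq_trans mlt lBA.
Qed.

(** When mu and nu are interchanged and M is replaced by its dual, the
    clauses on columns and on the lattice condition change places. *)
Record LR_data (lam mu nu : seq nat) (M : seq (seq nat)) : Prop := {
  LR_lam : is_part lam;
  LR_mu : is_part mu;
  LR_nu : is_part nu;
  LR_size : size M = size lam;
  LR_size_mu : size mu <= size lam;
  LR_size_nu : size nu <= size lam;
  LR_wf : wf M;
  LR_fits : fits (part mu) (part lam) M;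
  LR_weight : forall s, 0 < s <= size M ->
    count_mem s (flatten (fill (part mu) (part lam) M)) = part nu s;
  LR_strict : forall i, 0 < i < size M -> strict_rows i (part mu i - part mu i.+1) M;
  LR_lattice : forall i, 0 < i -> lattice_at i (part nu i - part nu i.+1) M }.

Lemma outer_fill z lam M : fits z (part lam) M -> size M = size lam ->
  outer (fill z (part lam) M) = lam.
Proof.
move=> fM sM; apply: (@eq_from_nth _ 0); first by rewrite size_map size_fill.
move=> i; rewrite size_map size_fill => iM.
rewrite (nth_map [::]) ?size_fill //.
have := @nth_fill z (part lam) M i.+1; rewrite /= iM => -> //.
by rewrite size_fillrow //; apply: fits_row_at.
Qed.

Lemma entry_fill z lam M i j : 0 < i <= size M ->
  entry (fill z lam M) i j = nth 0 (fillrow i (z i) (row_at M i) (lam i)) j.-1.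
Proof. by move=> iM; rewrite /entry nth_fill. Qed.

Lemma diagramE lam i j : is_part lam ->
  ((i, j) \in diagram lam) = [&& 0 < i, 0 < j & j <= part lam i].
Proof.
move=> pl; rewrite inE /= -!andbA; case: (posnP i) => //= i0.
rewrite -(part_pos pl i0); case: (posnP j) => [_|j0]; first by rewrite andbF.
by case: (leqP j (part lam i)) => jl; rewrite ?andbF // (leq_trans j0 jl).
Qed.

Lemma LR_data_LR lam mu nu M : LR_data lam mu nu M ->
  LR lam mu nu (fill (part mu) (part lam) M).
Proof.
case=> plam pmu pnu sM smu snu wM fM weight csM latM.
set T := fill _ _ M.
have oT : outer T = lam by apply: outer_fill.
have row i : 0 < i -> i <= size lam ->
    [/\ 0 < i <= size M, wf_row i (row_at M i) &
        part mu i + size (row_at M i) <= part lam i].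
  move=> i0 il; have iM : 0 < i <= size M by rewrite i0 sM.
  by split=> //; [apply: wf_row_at | apply: fits_row_at].
have rowsz i j : 0 < i -> 0 < j -> j <= part lam i -> i <= size lam.
  by move=> i0 j0 jl; rewrite -part_pos //; apply: leq_trans jl.
have eq0 i j : 0 < i -> 0 < j -> j <= part lam i ->
    (entry T i j == 0) = (j <= part mu i).
  move=> i0 j0 jl; have [iM wi fi] := row i i0 (rowsz i j i0 j0 jl).
  rewrite entry_fill // nth_fillrow_eq0 // ?prednK //.
split.
- split=> //.
    move=> i i0; case: (leqP i (size lam)) => il.
      by have [_ _ /(leq_trans _)->] := row i i0 il; rewrite ?leq_addr.
    by rewrite {1}/part nth_default //; case: i i0 il => // i _; exact: leq_trans smu.
  move=> i j; rewrite !diagramE // => /and3P[i0 j0 jl].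
  by rewrite eq0 // i0 j0.
- split=> // s s0; case: (leqP s (size M)) => sN; first by apply: weight; rewrite s0.
  rewrite count_fill_high // /part nth_default //.
  by case: s s0 sN => // s _ sN; rewrite /=; apply: leq_trans snu _; rewrite -sM.
- split.
    move=> i j j'; rewrite oT !diagramE // => /and3P[i0 j0 jl] /and3P[_ j0' jl'] _ _ jj.
    have [iM wi fi] := row i i0 (rowsz i j i0 j0 jl).
    rewrite !entry_fill //; apply: (sorted_leq_nth leq_trans leqnn 0 (fillrow_sorted _ _ wi)).
    + by rewrite inE size_fillrow // prednK.
    + by rewrite inE size_fillrow // prednK.
    by rewrite -ltnS !prednK // ltnW.
  move=> i i' j; rewrite oT !diagramE // => /and3P[i0 j0 jl] /and3P[i0' _ jl'] ij ij' ii.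
  have step k : i <= k -> k < i' -> 0 < entry T k.+1 j -> entry T k j < entry T k.+1 j.
    move=> ik ki; have k0 : 0 < k by apply: leq_trans ik.
    have jk : j <= part lam k.+1.
      by apply: leq_trans jl' _; apply: part_antiW.
    have kl := rowsz k.+1 j isT j0 jk.
    have [kM wk fk] := row k k0 (ltnW kl).
    have [kM' wk' fk'] := row k.+1 isT kl.
    have kM2 : 0 < k < size M by rewrite k0 sM.
    have [H _] := colstrict_fillrow k0 wk wk' fk fk' (part_anti plam k0) (part_anti pmu k0).
    rewrite !entry_fill //; exact: (H (csM k kM2)).
  have pos k : i <= k -> k <= i' -> 0 < entry T k j.
    move=> ik ki; have k0 : 0 < k by apply: leq_trans ik.
    have jk : j <= part lam k by apply: leq_trans jl' _; apply: part_antiW; rewrite ?k0.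
    rewrite lt0n eq0 // -ltnNge; apply: (@leq_ltn_trans (part mu i)).
      by apply: part_antiW; rewrite ?i0.
    by rewrite ltnNge -eq0 // -lt0n.
  have : forall k, i < k -> k <= i' -> entry T i j < entry T k j.
    elim=> // k IH; rewrite ltnS leq_eqVlt => /orP[/eqP<-|ik] ki.
      by apply: step => //; apply: pos.
    apply: ltn_trans (IH ik (ltnW ki)) _; apply: step => //; first exact: ltnW.
    by apply: pos => //; exact: leqW (ltnW ik).
  exact.
move=> r [|[|i]] // r0 _.
have nuE : part nu i.+2 <= part nu i.+1 by apply: part_anti.
have wt s : 0 < s -> count_mem s (flatten T) = part nu s.
  move=> s0; case: (leqP s (size M)) => sN; first by apply: weight; rewrite s0.
  rewrite count_fill_high // /part nth_default //.
  by case: s s0 sN => // s _ sN; rewrite /=; apply: leq_trans snu _; rewrite -sM.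
have hx : count_mem i.+1 (flatten T) =
    count_mem i.+2 (flatten T) + (part nu i.+1 - part nu i.+2).
  by rewrite !wt // subnKC.
have [_ H] := lattice_fill wM (ltn0Sn i) hx.
case: (leqP r (size M)) => rM.
  by apply: H; [exact: latM | rewrite r0].
have tr : take r T = T by rewrite take_oversize // size_fill ltnW.
have tr1 : take r.-1 T = T by rewrite take_oversize // size_fill -ltnS prednK.
by rewrite tr tr1 !wt.
Qed.

Lemma fill_exists z lam T :
  (forall i, i < size T -> let r := nth [::] T i in
     [/\ sorted leq r, all (fun x => x <= i.+1) r, count_mem 0 r = z i.+1
       & size r = lam i.+1]) ->
  exists M, [/\ T = fill z lam M, wf M, fits z lam M & size M = size T].
Proof.
elim/last_ind: T => [|T r IH] H; first by exists [::].
have [|M [TE wM fM sM]] := IH.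
  move=> i iT; have := H i; rewrite size_rcons ltnS (ltnW iT) nth_rcons iT.
  by apply.
have := H (size T); rewrite size_rcons ltnSn nth_rcons ltnn eqxx.
move=> /(_ isT) [sr ir cr szr].
exists ([seq x <- r | interior (size T).+1 x] :: M).
have rE : r = fillrow (size T).+1 (z (size T).+1)
    [seq x <- r | interior (size T).+1 x] (lam (size T).+1).
  by rewrite -cr -szr; apply: fillrow_canon.
split=> /=; last by rewrite sM.
- by rewrite sM -rE -TE.
- rewrite sM wM andbT /wf_row filter_all sorted_filter //; exact: leq_trans.
rewrite sM fM andbT -szr {2}rE /fillrow !size_cat !size_nseq addnA; exact: leq_addr.
Qed.

(** An entry s requires an entry s - 1 in a strictly higher row, and so on
    down to 1. *)
Lemma lattice_le T r s : lattice_permutation T ->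
  0 < count_mem s (flatten (take r T)) -> s <= r.
Proof.
move=> H; elim: s r => [|s IH] [|r] //; first by rewrite take0.
case: s IH => // s IH cs; rewrite ltnS; apply: (IH r).
by apply: leq_trans cs (H r.+1 s.+2 isT isT).
Qed.

Lemma count_zero_prefix (w : seq nat) m : m <= size w ->
  (forall j, j < size w -> (nth 0 w j == 0) = (j < m)) -> count_mem 0 w = m.
Proof.
move=> mw H; rewrite -[w in LHS](cat_take_drop m) count_cat.
have szt : size (take m w) = m by rewrite size_takel.
have -> : count_mem 0 (take m w) = m.
  rewrite -[RHS]szt; apply/eqP; rewrite -all_count; apply/(all_nthP 0) => j.
  rewrite szt => jm; rewrite nth_take //= H //; exact: leq_trans mw.
rewrite -[RHS]addn0; congr (_ + _); apply/eqP; rewrite -leqn0 leqNgt -has_count.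
apply/hasPn => x /(nthP 0) [j]; rewrite size_drop nth_drop => jw <- /=.
have jw' : m + j < size w by rewrite -ltn_subRL.
by rewrite H // -leqNgt leq_addr.
Qed.

Lemma LR_LR_data lam mu nu T : LR lam mu nu T ->
  exists2 M, LR_data lam mu nu M & T = fill (part mu) (part lam) M.
Proof.
move=> [[plam pmu sub oT zeroT] [pnu weight] [rowT colT] latT].
have sT : size T = size lam by rewrite -oT size_map.
have szrow i : i < size T -> size (nth [::] T i) = part lam i.+1.
  by move=> iT; rewrite -oT /part /= (nth_map [::]).
have smu : size mu <= size lam.
  case: (leqP (size mu) (size lam)) => // lm.
  have := sub (size lam).+1 isT; rewrite [X in _ <= X]/part nth_default //.
  by rewrite leqNgt part_pos // lm.
have eq0 i j : i < size T -> j < part lam i.+1 ->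
    (nth 0 (nth [::] T i) j == 0) = (j < part mu i.+1).
  by move=> iT jl; have := zeroT i.+1 j.+1; rewrite !diagramE //= jl => /(_ isT).
have [|M [TE wM fM sM]] := @fill_exists (part mu) (part lam) T.
  move=> i iT r; have szr : size r = part lam i.+1 by apply: szrow.
  split=> //.
  - apply/(sortedP 0) => j; rewrite szr => jl.
    have jl' : j < part lam i.+1 by apply: ltnW.
    case: (posnP (nth 0 r j)) => [->//|rj].
    have rj' : 0 < nth 0 r j.+1.
      move: rj; rewrite !lt0n /r !eq0 // -!leqNgt => /leq_trans; apply; exact: leqnSn.
    by apply: (rowT i.+1 j.+1 j.+2); rewrite ?oT ?diagramE //= ?jl ?jl'.
  - apply/allP => x xr; apply: (lattice_le latT).
    rewrite -mem_count; apply/flattenP; exists r => //.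
    have -> : r = nth [::] (take i.+1 T) i by rewrite nth_take.
    by apply: mem_nth; rewrite size_takel.
  apply: count_zero_prefix; first by rewrite szr; apply: sub.
  by move=> j; rewrite szr => jl; apply: eq0.
exists M => //.
have sML : size M = size lam by rewrite sM.
have wt s : 0 < s -> count_mem s (flatten T) = part nu s by apply: weight.
split=> //.
- case: (leqP (size nu) (size lam)) => // ln.
  have := wt (size lam).+1 isT; rewrite TE count_fill_high ?sML // => /esym/eqP.
  by rewrite -leqn0 leqNgt part_pos // ln.
- by move=> s /andP[s0 _]; rewrite -TE wt.
- move=> i /andP[i0 iM].
  have iM1 : 0 < i <= size M by rewrite i0 ltnW.
  have iM2 : 0 < i.+1 <= size M by [].
  have [_ H] := colstrict_fillrow i0 (wf_row_at wM iM1) (wf_row_at wM iM2)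
    (fits_row_at fM iM1) (fits_row_at fM iM2) (part_anti plam i0) (part_anti pmu i0).
  apply: H => j; rewrite -(nth_fill _ _ iM1) -(nth_fill _ _ iM2) -TE => Bj.
  case: (posnP (nth 0 (nth [::] T i.-1) j)) => [->//|Aj].
  have jB : j < part lam i.+1.
    rewrite -szrow ?sT -?sML // ltnNge; apply/negP => jB.
    by move: Bj; rewrite nth_default.
  have jA : j < part lam i by apply: leq_trans jB _; apply: part_anti.
  by apply: (colT i i.+1 j.+1); rewrite ?oT ?diagramE //= ?i0 ?jA ?jB.
move=> i i0.
have hx : count_mem i (flatten (fill (part mu) (part lam) M)) =
    count_mem i.+1 (flatten (fill (part mu) (part lam) M)) + (part nu i - part nu i.+1).
  by rewrite -TE !wt // subnKC // part_anti.
have [H _] := lattice_fill wM i0 hx.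
apply: H => r /andP[r0 _]; rewrite -TE; exact: latT.
Qed.

Lemma count_flatten_high D s : wf D -> size D <= s -> count_mem s (flatten D) = 0.
Proof.
elim: D => // K D IH wD sD.
have /andP[/andP[_ /allP iK] wD'] : wf_row (size D).+1 K && wf D := wD.
rewrite /= count_cat IH ?(ltnW sD) // addn0; apply/eqP.
rewrite -leqn0 leqNgt -has_count; apply/hasPn => x /iK /andP[_ xs] /=.
by rewrite ltn_eqF //; apply: leq_trans xs sD.
Qed.

Lemma lattice_at_total i x D : wf D -> 0 < i -> lattice_at i x D ->
  count_mem i (flatten D) <= count_mem i.+1 (flatten D) + x.
Proof.
move=> wD i0; elim: D x wD => [|K D IH] x wD //.
have /andP[wK wD'] : wf_row (size D).+1 K && wf D := wD.
case=> [Di|[Kx /(IH _ wD')]]; first by rewrite count_flatten_high.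
rewrite /= !count_cat; move: Kx.
move: (count_mem i K) (count_mem i.+1 K).
move: (count_mem i (flatten D)) (count_mem i.+1 (flatten D)).
clear; lia.
Qed.

(** By [lattice_at_dual] the column conditions of M are the lattice
    conditions of its dual, and by [dualK] the lattice conditions of M are
    the column conditions of its dual. *)
Lemma LR_data_dual lam mu nu M : LR_data lam mu nu M ->
  LR_data lam nu mu (dual M) /\
  partner (size M) (fill (part mu) (part lam) M) = fill (part nu) (part lam) (dual M).
Proof.
case=> plam pmu pnu sM smu snu wM fM weight csM latM.
have wD := wf_dual wM.
have latD i : 0 < i -> lattice_at i (part mu i - part mu i.+1) (dual M).
  move=> i0; case: (ltnP i (size M)) => iM.
    by apply/lattice_at_dual => //; apply: csM; rewrite i0.
  by apply: lattice_at_small; rewrite size_dual.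
(* The excess of letters s over letters s + 1 in the dual is at most
   mu_s - mu_(s+1); summing up from the last row bounds the number of letters
   s by mu_s. *)
have zM d s : 0 < s -> s + d = size M -> count_mem s (flatten (dual M)) <= part mu s.
  elim: d s => [|d IH] s s0 sd.
    by rewrite count_flatten_high // size_dual -sd addn0.
  apply: leq_trans (lattice_at_total wD s0 (latD s s0)) _.
  rewrite -[X in _ <= X](subnKC (part_anti pmu s0)) leq_add2r.
  by apply: IH => //; rewrite addSnnS.
have lp s : 0 < s <= size M -> 0 < part lam s.
  by move=> /andP[s0 sl]; rewrite part_pos // -sM.
have zM' s : 0 < s < size M -> count_mem s (flatten (dual M)) <= part mu s.
  by move=> /andP[s0 sl]; apply: (zM (size M - s)) => //; rewrite subnKC // ltnW.
have [pE fE wE] := partner_fill wM fM lp zM' weight.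
split=> //; split; rewrite ?size_dual //.
move=> i iM; have /andP[i0 il] := iM.
by apply/lattice_at_dual; rewrite ?size_dual // dualK //; apply: latM.
Qed.

Theorem theorem5p1 (n : nat) (T : tableau) (n_gt0 : 0 < n) (LR_T : LRn n T) :
  LRn n (partner n T) /\ partner n (partner n T) = T.
Proof.
case: LR_T => lam [mu [nu [ln /LR_LR_data[M dM ->]]]].
have [dD pE] := LR_data_dual dM.
have [_ pE'] := LR_data_dual dD.
have sM := LR_size dM.
have pn z D : size D = size M -> partner n (fill z (part lam) D) =
    partner (size D) (fill z (part lam) D).
  by move=> sD; rewrite partner_size size_fill // sD sM.
rewrite pn // pE; split.
  by exists lam, nu, mu; split=> //; apply: LR_data_LR.
by rewrite pn; [rewrite pE' dualK // (LR_wf dM) | rewrite size_dual].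
Qed.
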